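(* For any $0<r<\frac12\log 2$, $$\mu(K_r)=\frac{4r^2\log(1/r)}{\zeta(2)}+O(r^2),$$ where $\zeta(2)=\pi^2/6$ and the implied constant is absolute.
   Context: $X=\mathrm{SL}_2(\mathbb{R})/\mathrm{SL}_2(\mathbb{Z})$ is the space of unimodular lattices in $\mathbb{R}^2$, and $\mu$ is the $\mathrm{SL}_2(\mathbb{R})$-invariant probability measure on $X$. $\|\cdot\|$ denotes the supremum norm on $\mathbb{R}^2$. For $\Lambda\in X$ let $\Delta(\Lambda)=\sup_{v\in\Lambda\smallsetminus\{0\}}\log(1/\|v\|)$, and for $r\ge0$ let $K_r=\Delta^{-1}([0,r])$, the set of lattices all of whose nonzero vectors have supremum norm at least $e^{-r}$. *)

(* Defs.v *)
From HB Require Import structures.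
From mathcomp Require Import all_boot all_order all_algebra.
From mathcomp Require Import all_classical all_reals all_analysis.
Set Implicit Arguments. Unset Strict Implicit. Unset Printing Implicit Defensive.
Import Order.TTheory GRing.Theory Num.Theory.
Import numFieldNormedType.Exports.
Local Open Scope classical_set_scope.
Local Open Scope ring_scope.

Section Lattices.
Variable R : realType.

(* A 2x2 real matrix g, encoded by its two columns: g = ((a, c), (b, d))
   stands for the matrix [[a, b], [c, d]], with columns v1 = (a, c) and
   v2 = (b, d).  The lattice associated with g is g Z^2 = Z v1 + Z v2. *)
Definition mat2 := ((R * R) * (R * R))%type.

Definition col1 (g : mat2) : R * R := g.1.
Definition col2 (g : mat2) : R * R := g.2.

Definition det2 (g : mat2) : R :=
  (col1 g).1 * (col2 g).2 - (col2 g).1 * (col1 g).2.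

Definition supnorm (v : R * R) : R := Num.max `|v.1| `|v.2|.

Definition latvec (g : mat2) (m n : int) : R * R :=
  (m%:~R * (col1 g).1 + n%:~R * (col2 g).1,
   m%:~R * (col1 g).2 + n%:~R * (col2 g).2).

Definition Delta (g : mat2) : R :=
  sup [set x : R | exists m n : int, (m, n) != (0, 0) /\
                   x = ln (1 / supnorm (latvec g m n))].

Definition K (r : R) : set mat2 := [set g | 0 <= Delta g <= r].

(* Fundamental domain (up to a null set, and counting each lattice twice,
   via the bases (v1, v2) and (-v1, -v2)) for the right action of SL_2(Z)
   on SL_2(R): Lagrange--Gauss reduced bases, |v1| <= |v2| and
   2 |<v1, v2>| <= |v1|^2 (Euclidean norm). *)
Definition reduced (g : mat2) : Prop :=
  (col1 g).1 ^+ 2 + (col1 g).2 ^+ 2 <= (col2 g).1 ^+ 2 + (col2 g).2 ^+ 2 /\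
  2 * `|(col1 g).1 * (col2 g).1 + (col1 g).2 * (col2 g).2|
     <= (col1 g).1 ^+ 2 + (col1 g).2 ^+ 2.

Definition normalize (M : mat2) : mat2 :=
  let s := Num.sqrt (det2 M) in
  (((col1 M).1 / s, (col1 M).2 / s), ((col2 M).1 / s, (col2 M).2 / s)).

(* Haar measure on SL_2(R): m(A) = Lebesgue measure in M_2(R) = R^4 of the
   cone {s g | 0 < s <= 1, g in A}. *)
Definition cone (A : set mat2) : set mat2 :=
  [set M | 0 < det2 M <= 1 /\ A (normalize M)].

Definition leb4 : set mat2 -> \bar R :=
  ((@lebesgue_measure R \x @lebesgue_measure R) \x
   (@lebesgue_measure R \x @lebesgue_measure R))%E.

(* mu(E) for an SL_2(Z)-invariant set E of (bases of) unimodular lattices: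
   the Haar measure of E inside the fundamental domain, normalised so that
   mu is a probability measure on X = SL_2(R)/SL_2(Z). *)
Definition mu (E : set mat2) : R :=
  fine (leb4 (cone (reduced `&` E))) / fine (leb4 (cone reduced)).

Definition zeta2 : R := pi ^+ 2 / 6.

End Lattices.

(* Main.v *)
Require Import Defs.
From HB Require Import structures.
From mathcomp Require Import all_boot all_order all_algebra.
From mathcomp Require Import all_classical all_reals all_analysis.
From mathcomp Require Import measurable_realfun.
From mathcomp Require Import ring lra.
Set Implicit Arguments. Unset Strict Implicit. Unset Printing Implicit Defensive.
Import Order.TTheory GRing.Theory Num.Theory.
Import numFieldNormedType.Exports.
Local Open Scope classical_set_scope.
Local Open Scope ring_scope.

(** Write a matrix as [[a, b], [c, d]].  Substituting d = (D + b c) / a, where D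
    is the determinant, and rescaling a, b, c by sqrt D turns the volume of a
    cone into half the integral of da db dc / |a| over the slice D = 1.

    For the reduced matrices put b = x a - c / (a^2 + c^2): the slice becomes
    |x| <= 1/2 and a^2 + c^2 <= 1 / sqrt (1 - x^2), so integrating the area of a
    disc gives (1/2) * pi * (pi / 3) = zeta(2).

    Let q = exp(-r).  After a quarter turn, which preserves everything in sight,
    a reduced basis of a lattice in K_r has |c| <= |a|.  For small r it then
    satisfies |a|, |d| >= q and, outside boxes of volume O(r^2), also b c <= 0,
    hence |b| |c| <= 1 - q |a|; conversely this condition with b between
    constant multiples of sqrt r and 1 forces every lattice vector to have sup
    norm at least q, because the two terms of one of its coordinates have the
    same sign.  The volume of this region is
    (1 - q^2)^2 (1 + O(r)) (log (1 / sqrt r) + O(1)), and there are two copies of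
    it, so the total is 4 r^2 log (1 / r) + O(r^2). *)

(** * Lebesgue integration on the line *)

(* No measurability is required, so that K r need not be shown measurable. *)
Lemma le_integral_nonmeas (d : measure_display) (T : measurableType d) (R : realType)
    (m : {measure set T -> \bar R}) (f g : T -> \bar R) :
  (forall x, 0 <= f x)%E -> (forall x, f x <= g x)%E ->
  (\int[m]_x f x <= \int[m]_x g x)%E.
Proof.
move=> f0 fg; have g0 x : (0 <= g x)%E by exact: le_trans (fg x).
rewrite !ge0_integralTE//; apply: ereal_sup_le => _ [h hf <-].
by exists h => // x; exact: le_trans (fg x).
Qed.

(** The measure is given on every set by an outer measure, and outer measures are monotone without
    any measurability. *)
Lemma le_lebesgue_measure (R : realType) (A B : set R) :
  A `<=` B -> (@lebesgue_measure R A <= lebesgue_measure B)%E.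
Proof.
move=> AB; rewrite /lebesgue_measure /lebesgue_stieltjes_measure.
by rewrite /measure_extension; apply: le_mu_ext.
Qed.

Lemma le_leb4 (R : realType) (A B : set (mat2 R)) :
  A `<=` B -> (leb4 A <= leb4 B)%E.
Proof.
move=> AB; apply: le_integral_nonmeas => x /=.
  by apply: integral_ge0 => y _.
apply: le_integral_nonmeas => y //=; apply: le_lebesgue_measure => z.
by rewrite /xsection /= !inE /= !inE; exact: AB.
Qed.

(** * Affine substitutions and measurability of elementary functions *)

Section affine.
Context {R : realType}.
Local Notation mu := (@lebesgue_measure R).

(** Writing 1/x as x (x^2)^(-1) reduces the claim to real powers of nonnegative numbers. At 0 both
    sides are 0, by the convention for the inverse of 0. *)
Lemma inv_measurable : measurable_fun [set: R] (@GRing.inv R).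
Proof.
have -> : @GRing.inv R = (fun x => x * (x ^+ 2) `^ (-1)).
  apply/funext => x; have [->|x0] := eqVneq x 0; first by rewrite invr0 mul0r.
  rewrite powRN powRr1 ?sqr_ge0//.
  by rewrite expr2 invfM mulrA divff// mul1r.
apply: measurable_funM => //.
apply: (@measurableT_comp _ _ _ _ _ _ (fun y : R => y `^ (-1)) _ (fun x : R => x ^+ 2)).
  exact: measurable_powR.
exact: (@measurable_funX _ _ _ _ id).
Qed.

Lemma sqrt_measurable : measurable_fun [set: R] (@Num.sqrt R).
Proof. by apply: continuous_measurable_fun; exact: sqrt_continuous. Qed.

(** The pushforward of Lebesgue measure under x |-> a x + b, scaled by |a|, gives each interval ]u,
    v] the length v - u, so it is Lebesgue measure by uniqueness. *)
Lemma ge0_integral_affine (a b : R) (f : R -> \bar R) : a != 0 ->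
  measurable_fun [set: R] f -> (forall x, 0 <= f x)%E ->
  (\int[mu]_x f x = `|a|%:E * \int[mu]_x f (a * x + b)%R)%E.
Proof.
move=> a0 mf f0.
pose phi (x : R) : R := a * x + b.
have mphi : measurable_fun [set: measurableTypeR R] (phi : _ -> measurableTypeR R).
  by apply: measurable_funD => //; apply: measurable_funM.
pose nu := mscale (NngNum (normr_ge0 a)) (pushforward mu (phi : measurableTypeR R -> measurableTypeR R)).
have muE A : measurable A -> mu A = nu mphi A.
  apply: (@lebesgue_measure_unique _ (nu mphi)) => _ [[u v]] _ <-.
  transitivity (`|a|%:E * mu (phi @^-1` `]u, v]))%E; last by [].
  have [ag|al|a00] := ltgtP 0 a; last by rewrite -a00 eqxx in a0.
  - have -> : phi @^-1` `]u, v] = `](u - b) / a, (v - b) / a]%classic.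
      apply/seteqP; split => x /=; rewrite !in_itv/= /phi.
        by rewrite ltr_pdivrMr// ler_pdivlMr// ltrBlDr lerBrDr [a * _]mulrC.
      by rewrite ltr_pdivrMr// ler_pdivlMr// ltrBlDr lerBrDr [a * _]mulrC.
    rewrite !lebesgue_measure_itv/= !lte_fin ltr_pM2r ?invr_gt0// ltrD2r.
    case: ifP => _; last by rewrite mule0.
    by rewrite gtr0_norm// -!EFinD -EFinM; congr EFin; field.
  - have -> : phi @^-1` `]u, v] = `[(v - b) / a, (u - b) / a[%classic.
      apply/seteqP; split => x /=; rewrite !in_itv/= /phi.
        by rewrite ler_ndivrMr// ltr_ndivlMr// ltrBlDr lerBrDr [a * _]mulrC andbC.
      by rewrite ler_ndivrMr// ltr_ndivlMr// ltrBlDr lerBrDr [a * _]mulrC andbC.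
    rewrite !lebesgue_measure_itv/= !lte_fin ltr_nM2r ?invr_lt0// ltrD2r.
    case: ifP => _; last by rewrite mule0.
    by rewrite ltr0_norm// -!EFinD -EFinM; congr EFin; field.
transitivity (\int[nu mphi]_x f x)%E.
  by apply: eq_measure_integral => A mA _; exact: muE.
rewrite ge0_integral_mscale//; congr (_ * _)%E.
by rewrite ge0_integral_pushforward.
Qed.

Lemma normr_measurable_fun (d : measure_display) (T : measurableType d) (f : T -> R) :
  measurable_fun [set: T] f -> measurable_fun [set: T] (fun x => `|f x|).
Proof. by move=> mf; apply: measurableT_comp. Qed.

Lemma inv_measurable_fun (d : measure_display) (T : measurableType d) (f : T -> R) :
  measurable_fun [set: T] f -> measurable_fun [set: T] (fun x => (f x)^-1).
Proof. by move=> mf; apply: measurableT_comp => //; exact: inv_measurable. Qed.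

Lemma sqrt_measurable_fun (d : measure_display) (T : measurableType d) (f : T -> R) :
  measurable_fun [set: T] f -> measurable_fun [set: T] (fun x => Num.sqrt (f x)).
Proof. by move=> mf; apply: measurableT_comp => //; exact: sqrt_measurable. Qed.

Lemma nat_of_bool_measurable_fun (d : measure_display) (T : measurableType d) (P : T -> bool) :
  measurable_fun [set: T] P -> measurable_fun [set: T] (fun x => (P x)%:R : R).
Proof.
move=> mP.
have -> : (fun x => (P x)%:R : R) = (fun x => if P x then 1 else 0).
  by apply/funext => x; case: (P x).
by apply: measurable_fun_ifT.
Qed.

Lemma measurable_boolset (d : measure_display) (T : measurableType d) (P : T -> bool) :
  measurable_fun [set: T] P -> measurable [set x | P x].
Proof.
move=> mP; rewrite (_ : [set x | P x] = [set: T] `&` P @^-1` [set true]).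
  exact: mP.
by rewrite setTI.
Qed.

Lemma measurable_fst_comp (d d1 d2 : measure_display) (T : measurableType d)
  (T1 : measurableType d1) (T2 : measurableType d2) (f : T -> T1 * T2) :
  measurable_fun [set: T] f -> measurable_fun [set: T] (fun x => (f x).1).
Proof. by move=> mf; apply: measurableT_comp. Qed.

Lemma measurable_snd_comp (d d1 d2 : measure_display) (T : measurableType d)
  (T1 : measurableType d1) (T2 : measurableType d2) (f : T -> T1 * T2) :
  measurable_fun [set: T] f -> measurable_fun [set: T] (fun x => (f x).2).
Proof. by move=> mf; apply: measurableT_comp. Qed.
End affine.

(** * Iterated integrals and tactics for their side conditions *)

Section tonelli.
Context {R : realType}.
Lemma measurable_integral (d : measure_display) (T : measurableType d) (f : T -> R -> \bar R) :
  measurable_fun [set: T * R] (fun z => f z.1 z.2) -> (forall x y, 0 <= f x y)%E ->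
  measurable_fun [set: T] (fun x => \int[@lebesgue_measure R]_y f x y)%E.
Proof.
move=> mf f0.
exact: (@measurable_fun_fubini_tonelli_F _ _ _ (measurableTypeR R) R (@lebesgue_measure R) (fun z => f z.1 z.2)).
Qed.

Lemma tonelli (f : R -> R -> \bar R) :
  measurable_fun [set: R * R] (fun z => f z.1 z.2) -> (forall x y, 0 <= f x y)%E ->
  (\int[@lebesgue_measure R]_x \int[@lebesgue_measure R]_y f x y = \int[@lebesgue_measure R]_y \int[@lebesgue_measure R]_x f x y)%E.
Proof.
move=> mf f0.
exact: (@fubini_tonelli _ _ (measurableTypeR R) (measurableTypeR R) R (@lebesgue_measure R) (@lebesgue_measure R) (fun z => f z.1 z.2)).
Qed.
End tonelli.

(** Directed by the syntax of the function. Each integral produces a measurability goal for the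
    joint integrand and a nonnegativity goal, the latter usually left to [nonneg]. The cases with a
    partially applied operator catch eta-reduced functions. *)
Ltac meas := repeat match goal with
| |- measurable_fun _ (fun x => ?c) => exact: measurable_cst
| |- measurable_fun _ id => exact: measurable_id
| |- measurable_fun _ (fun x => x) => exact: measurable_id
| |- measurable_fun _ fst => exact: measurable_fst
| |- measurable_fun _ snd => exact: measurable_snd
| |- measurable_fun _ (fun x => integral _ _ (@?f x)) =>
    apply: (@measurable_integral _ _ _ f); [cbn beta | move=> ? ?; cbn beta]
| |- measurable_fun ?D (@Order.lt _ _ ?c) => apply: (@measurable_fun_ltr _ _ _ D (fun=> c) id)
| |- measurable_fun ?D (@Order.le _ _ ?c) => apply: (@measurable_fun_ler _ _ _ D (fun=> c) id)
| |- measurable_fun ?D (@GRing.add _ ?c) => apply: (@measurable_funD _ _ _ D (fun=> c) id)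
| |- measurable_fun ?D (@GRing.mul _ ?c) => apply: (@measurable_funM _ _ _ D (fun=> c) id)
| |- measurable_fun _ (@Num.Def.normr _ _) => exact: normr_measurable
| |- measurable_fun _ (@GRing.inv _) => exact: inv_measurable
| |- measurable_fun _ (fun x => EFin _) => apply/measurable_EFinP
| |- measurable_fun _ (fun x => (@?f x + @?g x)%R) => apply: (@measurable_funD _ _ _ _ f g)
| |- measurable_fun _ (fun x => (@?f x * @?g x)%R) => apply: (@measurable_funM _ _ _ _ f g)
| |- measurable_fun _ (fun x => (- (@?f x))%R) => apply: (@measurable_funN _ _ _ _ f)
| |- measurable_fun _ (fun x => (@?f x) ^+ ?n) => apply: (@measurable_funX _ _ _ _ f n)
| |- measurable_fun _ (fun x => (@?f x)^-1) => apply: inv_measurable_fun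
| |- measurable_fun _ (fun x => `|@?f x|) => apply: normr_measurable_fun
| |- measurable_fun _ (fun x => Num.sqrt (@?f x)) => apply: sqrt_measurable_fun
| |- measurable_fun _ (fun x => (nat_of_bool (@?f x))%:R) => apply: nat_of_bool_measurable_fun
| |- measurable_fun _ (fun x => (@?f x) && (@?g x)) => apply: measurable_and
| |- measurable_fun _ (fun x => (@?f x) || (@?g x)) => apply: measurable_or
| |- measurable_fun _ (fun x => ~~ (@?f x)) => apply: measurable_neg
| |- measurable_fun _ (fun x => (@?f x) <= (@?g x)) => apply: measurable_fun_ler
| |- measurable_fun _ (fun x => (@?f x) < (@?g x)) => apply: measurable_fun_ltr
| |- measurable_fun _ (fun x => (@?f x).1) => apply: measurable_fst_comp
| |- measurable_fun _ (fun x => (@?f x).2) => apply: measurable_snd_comp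
| |- measurable_fun _ (fun x => (_, _)) => apply: measurable_fun_pair
end.

Ltac nonneg := repeat (apply: integral_ge0 => ? _); by rewrite ?lee_fin.

(** * Slices of the cone measure *)

Section slices.
Context {R : realType}.
Local Notation mu := (@lebesgue_measure R).
Implicit Types P Q : mat2 R -> bool.

Lemma lebesgue_measure_boolset (P : R -> bool) : measurable_fun [set: R] P ->
  mu [set x | P x] = (\int[mu]_x ((P x)%:R)%:E)%E.
Proof.
move=> mP; transitivity (\int[mu]_x (\1_[set x | P x] x)%:E)%E.
  by rewrite integral_indic// ?setIT//; exact: measurable_boolset.
by apply: eq_integral => x _; rewrite indicE mem_setE.
Qed.

(** Since {0} is a null set, substitutions that divide by the integration variable are harmless. *)
Lemma integral_neq0 (f g : R -> \bar R) :
  measurable_fun [set: R] f -> measurable_fun [set: R] g ->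
  (forall x, 0 <= f x)%E -> (forall x, 0 <= g x)%E ->
  (forall x, x != 0 -> f x = g x) ->
  (\int[mu]_x f x = \int[mu]_x g x)%E.
Proof.
move=> mf mg f0 g0 fg.
rewrite (@ge0_negligible_integral _ _ _ mu setT [set 0])//; last exact: lebesgue_measure_set1.
rewrite [RHS](@ge0_negligible_integral _ _ _ mu setT [set 0])//; last exact: lebesgue_measure_set1.
apply: eq_integral => x; rewrite inE /= => -[_ /eqP x0]; exact: fg.
Qed.

Lemma integral_leb2 (f : R * R -> \bar R) :
  measurable_fun [set: R * R] f -> (forall x, 0 <= f x)%E ->
  (\int[mu \x mu]_v f v = \int[mu]_a \int[mu]_c f (a, c))%E.
Proof.
move=> mf f0.
exact: (@fubini_tonelli1 _ _ (measurableTypeR R) (measurableTypeR R) R mu mu f).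
Qed.

Lemma leb2_boolset (P : R * R -> bool) : measurable_fun [set: R * R] P ->
  ((mu \x mu) [set v | P v] = \int[mu]_a \int[mu]_c ((P (a, c))%:R)%:E)%E.
Proof.
move=> mP; apply: eq_integral => x _ /=.
rewrite -lebesgue_measure_boolset; last first.
  by apply: (measurableT_comp mP); meas.
by congr (mu _); apply/seteqP; split => y; rewrite /xsection/= inE.
Qed.

Lemma leb4_boolset Q : measurable_fun [set: mat2 R] Q ->
  (leb4 [set M | Q M] =
   \int[mu]_a \int[mu]_c \int[mu]_b \int[mu]_d ((Q ((a, c), (b, d)))%:R)%:E)%E.
Proof.
move=> mQ.
transitivity (\int[mu \x mu]_v (\int[mu]_b \int[mu]_d ((Q (v, (b, d)))%:R)%:E))%E.
  apply: eq_integral => v _ /=.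
  rewrite -(@leb2_boolset (fun w => Q (v, w))); last first.
    by apply: (measurableT_comp mQ); meas.
  by congr (product_measure1 _ _ _); apply/seteqP; split => y; rewrite /xsection/= inE.
rewrite integral_leb2//.
- by meas; [apply: (measurableT_comp mQ); meas|nonneg..].
- by move=> *; nonneg.
Qed.

Lemma FTC2_is_derive (f F : R -> R) (a b : R) : a < b ->
  (forall x, a <= x <= b -> is_derive x 1 F (f x)) ->
  (forall x, a <= x <= b -> {for x, continuous f}) ->
  (\int[mu]_(x in `[a, b]) (f x)%:E = (F b - F a)%:E)%E.
Proof.
move=> ab dF cf.
have cF x : a <= x <= b -> {for x, continuous F}.
  move=> /dF dFx; apply/differentiable_continuous; rewrite -derivable1_diffP.
  exact: ex_derive.
rewrite (@continuous_FTC2 _ f F)// ?EFinB//.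
- apply: continuous_in_subspaceT => x; rewrite inE/= in_itv/=; exact: cf.
- split.
  + by move=> x; rewrite in_itv/= => /andP[/ltW ax /ltW xb]; have := dF x; rewrite ax xb => /(_ isT) ?; exact: ex_derive.
  + by apply: cvg_at_right_filter; apply: cF; rewrite lexx ltW.
  + by apply: cvg_at_left_filter; apply: cF; rewrite lexx ltW.
- move=> x; rewrite in_itv/= => /andP[/ltW ax /ltW xb]; rewrite derive1E.
  by apply: derive_val; apply: dF; rewrite ax.
Qed.

Lemma integral_itv01_id : (\int[mu]_x ((0 < x <= 1)%R%:R * x)%R%:E = (2^-1)%:E)%E.
Proof.
transitivity (\int[mu]_(x in `[0%R, 1%R]) (x%:E))%E.
  rewrite [RHS]integral_mkcond; apply: eq_integral => x _.
  rewrite patchE mem_setE in_itv/=; have [x0|x0|<-] := ltgtP 0 x => /=.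
  - by case: (x <= 1); rewrite ?mul1r ?mul0r.
  - by rewrite mul0r.
  - by rewrite mulr0; case: ifP.
apply: etrans; first apply: (@FTC2_is_derive id (fun x : R => x ^+ 2 / 2)) => //.
- by move=> x _; apply: is_derive_eq; rewrite /GRing.scale/=; field.
- by move=> x _; exact: cvg_id.
by congr EFin; field.
Qed.

(** Haar measure of SL_2(R) in the coordinates a, c, b has density 1/|a|, the entry d being
    determined by a d - b c = 1. For a = 0 the value is 0 by convention. *)
Definition slice_fun P (a c b : R) : \bar R :=
  (`|a|^-1 * (P ((a, c), (b, (1 + b * c) / a)))%:R)%:E.

Lemma slice_fun_ge0 P a c b : (0 <= slice_fun P a c b)%E.
Proof. by rewrite lee_fin mulr_ge0// invr_ge0. Qed.

Lemma measurable_slice_fun P (d : measure_display) (T : measurableType d) (f g h : T -> R) :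
  measurable_fun [set: mat2 R] P ->
  measurable_fun [set: T] f -> measurable_fun [set: T] g -> measurable_fun [set: T] h ->
  measurable_fun [set: T] (fun x => slice_fun P (f x) (g x) (h x)).
Proof.
move=> mP mf mg mh; rewrite /slice_fun; meas => //.
by apply: (measurableT_comp mP); meas.
Qed.

Lemma leb4_cone P : measurable_fun [set: mat2 R] P ->
  (leb4 (cone [set g | P g]) =
   (2^-1)%:E * \int[mu]_a \int[mu]_c \int[mu]_b slice_fun P a c b)%E.
Proof.
move=> mP.
pose Q (M : mat2 R) := (0 < det2 M <= 1) && P (normalize M).
have mQ : measurable_fun [set: mat2 R] Q.
  rewrite /Q /det2 /Defs.col1 /Defs.col2; meas.
  by apply: (measurableT_comp mP); rewrite /normalize /det2 /Defs.col1 /Defs.col2; meas.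
have -> : cone [set g | P g] = [set M | Q M].
  by apply/seteqP; split => M; rewrite /cone /Q /= => /andP.
rewrite leb4_boolset//.
(* The integrand in the coordinates (a, c, b, D): [D] is the determinant, and 1/|a| is the Jacobian
   of d = (D + b c) / a. *)
pose H (a c b D : R) : \bar R :=
  (`|a|^-1 * ((0 < D <= 1) && P (normalize ((a, c), (b, (D + b * c) / a))))%:R)%:E.
have H0 a c b D : (0 <= H a c b D)%E.
  by rewrite lee_fin mulr_ge0// invr_ge0.
have mH d (T : measurableType d) (f g h k : T -> R) :
    measurable_fun [set: T] f -> measurable_fun [set: T] g ->
    measurable_fun [set: T] h -> measurable_fun [set: T] k ->
    measurable_fun [set: T] (fun x => H (f x) (g x) (h x) (k x)).
  move=> mf mg mh mk; rewrite /H; meas => //.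
  by apply: (measurableT_comp mP); rewrite /normalize /det2 /Defs.col1 /Defs.col2/=; meas.
have detE a c b D : a != 0 -> det2 ((a, c), (b, (D + b * c) / a)) = D.
  by move=> a0; rewrite /det2/=; field.
transitivity (\int[mu]_a \int[mu]_c \int[mu]_b \int[mu]_D H a c b D)%E.
  apply: integral_neq0.
  - by meas; [apply: (measurableT_comp mQ); meas|nonneg..].
  - by meas; [apply: mH; meas|nonneg..].
  - by move=> *; nonneg.
  - by move=> *; nonneg.
  move=> a a0; apply: eq_integral => c _; apply: eq_integral => b _.
  rewrite (@ge0_integral_affine R a^-1 (b * c / a)) ?invr_eq0//; last first.
  - by meas; apply: (measurableT_comp mQ); meas.
  rewrite -ge0_integralZl//.
  - apply: eq_integral => D _; rewrite -EFinM /H normfV; congr (_ * _)%:E.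
    rewrite /Q; have -> : a^-1 * D + b * c / a = (D + b * c) / a by field.
    by rewrite detE.
  - by meas; apply: (measurableT_comp mQ); meas.
transitivity (\int[mu]_D \int[mu]_a \int[mu]_c \int[mu]_b H a c b D)%E.
  rewrite [RHS](@tonelli R (fun D a => \int[mu]_c \int[mu]_b H a c b D))%E; last 2 first.
  - by meas; [apply: mH; meas|nonneg..].
  - by move=> *; nonneg.
  apply: eq_integral => a _.
  rewrite [RHS](@tonelli R (fun D c => \int[mu]_b H a c b D))%E; last 2 first.
  - by meas; [apply: mH; meas|nonneg..].
  - by move=> *; nonneg.
  apply: eq_integral => c _.
  by rewrite [RHS](@tonelli R (fun D b => H a c b D))%E//; apply: mH; meas.
set I := (\int[mu]_a \int[mu]_c \int[mu]_b slice_fun P a c b)%E.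
(* Scaling a, c, b by s = sqrt D contributes s^3 and the density 1/|a| contributes 1/s. The
   remaining factor s^2 = D integrates to 1/2 over ]0, 1]. *)
transitivity (\int[mu]_D (((0 < D <= 1)%R%:R * D)%R%:E * I))%E; last first.
  rewrite ge0_integralZr//.
  - by rewrite integral_itv01_id.
  - by meas.
  - move=> D _; rewrite lee_fin; case: (ltP 0 D) => //= D0; rewrite ?mul0r//.
    by rewrite mulr_ge0// ltW.
  - by apply: integral_ge0 => *; apply: integral_ge0 => *; apply: integral_ge0 => *; exact: slice_fun_ge0.
apply: eq_integral => D _.
have [/andP[D0 D1]|nD] := boolP (0 < D <= 1); last first.
  rewrite mul0r mul0e integral0_eq// => a _; rewrite integral0_eq// => c _.
  by rewrite integral0_eq// => b _; rewrite /H (negbTE nD) mulr0.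
pose s := Num.sqrt D.
have s0 : 0 < s by rewrite sqrtr_gt0.
have ss : s * s = D by rewrite -expr2 sqr_sqrtr// ltW.
have HE a c b : H (s * a) (s * c) (s * b) D = ((s^-1)%:E * slice_fun P a c b)%E.
  rewrite /H /slice_fun D0 D1/= -EFinM; congr EFin.
  have [->|a0] := eqVneq a 0; first by rewrite mulr0 normr0 invr0 !mul0r mulr0.
  rewrite normrM invfM gtr0_norm// -mulrA; congr (_ * (_ * (P _)%:R)).
  have sn0 : s != 0 by rewrite gt_eqF.
  rewrite /normalize detE/= ?mulf_neq0// -/s -ss.
  by congr (_, _, (_, _)); field; rewrite ?sn0 ?a0.
have scale f : measurable_fun [set: R] f -> (forall x, 0 <= f x)%E ->
    (\int[mu]_x f x = s%:E * \int[mu]_x f (s * x)%R)%E.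
  move=> mf f0; rewrite (@ge0_integral_affine R s 0) ?gt_eqF// gtr0_norm//.
  by under eq_integral do rewrite addr0.
rewrite scale; last 2 first.
- by meas; [apply: mH; meas|nonneg..].
- by move=> *; nonneg.
transitivity (s%:E * \int[mu]_a (s%:E * \int[mu]_c \int[mu]_b slice_fun P a c b))%E.
  congr (_ * _)%E; apply: eq_integral => a _.
  rewrite scale; last 2 first.
  - by meas; [apply: mH; meas|nonneg..].
  - by move=> *; nonneg.
  congr (_ * _)%E; apply: eq_integral => c _.
  rewrite scale; last 2 first.
  - by apply: mH; meas.
  - by [].
  under eq_integral do rewrite HE.
  rewrite ge0_integralZl//.
  - by rewrite muleA -EFinM mulfV ?gt_eqF// mul1e.
  - by apply: measurable_slice_fun => //; meas.
  - by move=> *; exact: slice_fun_ge0.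
  - by rewrite lee_fin invr_ge0 ltW.
rewrite ge0_integralZl//.
- by rewrite muleA -EFinM ss mul1r.
- meas; first by apply: measurable_slice_fun => //; meas.
  + exact: slice_fun_ge0.
  + by apply: integral_ge0 => *; exact: slice_fun_ge0.
- by move=> *; do 2 (apply: integral_ge0 => ? _); exact: slice_fun_ge0.
- by rewrite lee_fin ltW.
Qed.
End slices.

(** * The area of a disc and the arcsine integral *)

Section disc.
Context {R : realType}.
Local Notation mu := (@lebesgue_measure R).

Lemma integral_indic_itv (P : R -> bool) (u v : R) (g : R -> R) :
  (forall x, P x = (u <= x <= v)) ->
  (\int[mu]_x ((P x)%:R * g x)%R%:E = \int[mu]_(x in `[u, v]) (g x)%:E)%E.
Proof.
move=> PE; rewrite [RHS]integral_mkcond; apply: eq_integral => x _.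
rewrite patchE mem_setE in_itv/= PE.
by case: (u <= x <= v); rewrite ?mul1r ?mul0r.
Qed.

Lemma ge0_integral_even (f : R -> \bar R) :
  measurable_fun [set: R] f -> (forall x, 0 <= f x)%E -> (forall x, f (- x) = f x) ->
  (\int[mu]_x f x = 2%:E * \int[mu]_x ((0 <= x)%R%:R%:E * f x))%E.
Proof.
move=> mf f0 fE.
have mg : measurable_fun [set: R] (fun x : R => (((0 <= x)%R%:R)%:E * f x)%E).
  by apply: emeasurable_funM => //; meas.
have g0 x : (0 <= ((0 <= x)%R%:R)%:E * f x)%E.
  by rewrite mule_ge0 ?lee_fin.
have mgN : measurable_fun [set: R] (fun x : R => (((0 <= - x)%R%:R)%:E * f (- x)%R)%E).
  by apply: (measurableT_comp mg); meas.
rewrite mule_natl mule2n.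
rewrite [X in (_ + X)%E](@ge0_integral_affine R (-1) 0)// ?oppr_eq0 ?oner_eq0//.
rewrite normrN normr1 mul1e.
under [X in (_ + X)%E]eq_integral do rewrite addr0 mulN1r.
rewrite -ge0_integralD//.
apply: integral_neq0 => //.
- exact: emeasurable_funD.
- by move=> x; rewrite adde_ge0.
- move=> x x0; rewrite fE oppr_ge0.
  have [xp|xn|xe] := ltgtP 0 x; rewrite ?mul1e ?mul0e ?adde0 ?add0e//.
  by rewrite -xe eqxx in x0.
Qed.

Lemma integral_abs_sqr_le (k : R) : 0 < k ->
  (\int[mu]_a (`|a| * (a ^+ 2 <= k)%R%:R)%R%:E = k%:E)%E.
Proof.
move=> k0.
rewrite ge0_integral_even; last 3 first.
- by meas.
- by move=> x; rewrite lee_fin mulr_ge0.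
- by move=> x; rewrite normrN sqrrN.
have s0 : 0 < Num.sqrt k by rewrite sqrtr_gt0.
have sk : Num.sqrt k ^+ 2 = k by rewrite sqr_sqrtr// ltW.
transitivity (2%:E * \int[mu]_a (((0 <= a)%R && (a ^+ 2 <= k)%R)%:R * a)%R%:E)%E.
  congr (_ * _)%E; apply: eq_integral => a _; rewrite -EFinM; congr EFin.
  have [a0|a0] := leP 0 a; last by rewrite !mul0r.
  by rewrite ger0_norm// mul1r mulrC.
have PE x : (0 <= x)%R && (x ^+ 2 <= k)%R = (0 <= x <= Num.sqrt k).
  have [x0|//] := leP 0 x.
  by rewrite -[in LHS]sk ler_pXn2r ?nnegrE// ltW.
rewrite (integral_indic_itv _ PE).
have -> : (\int[mu]_(x in `[0%R, Num.sqrt k]) x%:E = (k / 2)%:E)%E.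
  apply: etrans; first apply: (@FTC2_is_derive R id (fun x : R => x ^+ 2 / 2)) => //.
  - by move=> x _; apply: is_derive_eq; rewrite /GRing.scale/=; field.
  - by move=> x _; exact: cvg_id.
  by rewrite /= sk; congr EFin; field.
by rewrite -EFinM; congr EFin; field.
Qed.

Lemma integralT_oneDsqr : (\int[mu]_t ((1 + t ^+ 2)^-1)%R%:E = pi%:E)%E.
Proof.
rewrite ge0_integral_even; last 3 first.
- by meas.
- by move=> x; rewrite lee_fin invr_ge0 addr_ge0// sqr_ge0.
- by move=> x; rewrite sqrrN.
transitivity (2%:E * (pi / 2 : R)%R%:E)%E; last by rewrite -EFinM; congr EFin; field.
rewrite -(@integral0y_oneDsqr R) [in RHS]integral_mkcond; congr (_ * _)%E.
apply: eq_integral => x _; rewrite patchE mem_setE in_itv/= andbT.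
by case: (0 <= x); rewrite ?mul1e ?mul0e//.
Qed.

(** The substitution c = a t turns the disc into a^2 (1 + t^2) <= s with density |a|. Integrating
    over a first leaves s / (1 + t^2), whose integral over the line is pi s. *)
Lemma disc_area (s : R) : 0 < s ->
  (\int[mu]_a \int[mu]_c (a ^+ 2 + c ^+ 2 <= s)%R%:R%:E = (pi * s)%:E)%E.
Proof.
move=> s0.
transitivity (\int[mu]_a \int[mu]_t (`|a| * (a ^+ 2 * (1 + t ^+ 2) <= s)%R%:R)%R%:E)%E.
  apply: integral_neq0.
  - by meas; nonneg.
  - by meas; rewrite lee_fin mulr_ge0.
  - by move=> *; nonneg.
  - by move=> *; apply: integral_ge0 => *; rewrite lee_fin mulr_ge0.
  move=> a a0; rewrite (@ge0_integral_affine R a 0)//; last by meas.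
  rewrite -ge0_integralZl//; last by meas.
  apply: eq_integral => t _; rewrite -EFinM addr0; congr (_ * (_ <= _)%R%:R)%R%:E.
  by ring.
rewrite (@tonelli R (fun a t => (`|a| * (a ^+ 2 * (1 + t ^+ 2) <= s)%R%:R)%R%:E)); last 2 first.
- by meas.
- by move=> *; rewrite lee_fin mulr_ge0.
transitivity (\int[mu]_t (s%:E * ((1 + t ^+ 2)^-1)%R%:E))%E.
  apply: eq_integral => t _.
  have t0 : 0 < 1 + t ^+ 2 by rewrite ltr_pwDl// sqr_ge0.
  rewrite -EFinM -integral_abs_sqr_le ?divr_gt0//.
  by apply: eq_integral => a _; rewrite ler_pdivlMr.
rewrite ge0_integralZl//.
- by rewrite integralT_oneDsqr -EFinM mulrC.
- by meas.
- by move=> t _; rewrite lee_fin invr_ge0 addr_ge0// sqr_ge0.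
- by rewrite lee_fin ltW.
Qed.

(* sin (3 w) = 3 s - 4 s^3 at w = pi / 6 gives (s + 1) (2 s - 1)^2 = 0. *)
Lemma sin_pi6 : sin (pi / 6) = 2^-1 :> R.
Proof.
set w := pi / 6 : R; set s := sin w.
have pi0 := pi_gt0 R.
have sin3 : sin (w + (w + w)) = 3 * s - 4 * s ^+ 3.
  rewrite sinD sinD cosD -/s.
  have := cos2Dsin2 w; rewrite -/s => h.
  have -> : cos w * (s * cos w + cos w * s) = 2 * s * cos w ^+ 2 by ring.
  have -> : cos w * cos w = cos w ^+ 2 by ring.
  have -> : cos w ^+ 2 = 1 - s ^+ 2 by rewrite -h; ring.
  by ring.
have w3 : w + (w + w) = pi / 2 by rewrite /w; field.
have s0 : 0 < s.
  by apply: sin_gt0_pi; rewrite /w; apply/andP; split; lra.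
move: sin3; rewrite w3 sin_pihalf => e.
have /eqP : (s + 1) * (2 * s - 1) ^+ 2 = 0.
  by transitivity (1 - (3 * s - 4 * s ^+ 3)); [ring | rewrite -e subrr].
by rewrite mulf_eq0 expf_eq0/= => /orP[/eqP|/eqP]; lra.
Qed.

(** The antiderivative [asin] takes the values pi / 6 and - pi / 6 at the endpoints. *)
Lemma integral_inv_sqrt :
  (\int[mu]_(x in `[(- 2^-1)%R, 2^-1%R]) ((Num.sqrt (1 - x ^+ 2))^-1)%R%:E = (pi / 3)%:E)%E.
Proof.
have asin2 : asin (2^-1) = pi / 6 :> R.
  rewrite -sin_pi6 sinK// in_itv/=; have := pi_gt0 R; lra.
have asinN2 : asin (- 2^-1) = - (pi / 6) :> R.
  rewrite -sin_pi6 -sinN sinK// in_itv/=; have := pi_gt0 R; lra.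
have h1 (x : R) : - 2^-1 <= x <= 2^-1 -> 0 < 1 - x ^+ 2.
  by move=> /andP[? ?]; nra.
apply: etrans; first apply: (@FTC2_is_derive R (fun x => (Num.sqrt (1 - x ^+ 2))^-1) (@asin R)).
- by lra.
- by move=> x x12; apply: is_derive1_asin; move: x12; lra.
- move=> x /h1 x12; apply: cvgV; first by rewrite gt_eqF// sqrtr_gt0.
  apply: continuous_cvg; first exact: sqrt_continuous.
  apply: cvgB; first exact: cvg_cst.
  by apply: cvgM; exact: cvg_id.
by rewrite asin2 asinN2; congr EFin; field.
Qed.

End disc.

(** * The covolume *)

Section reduced_volume.
Context {R : realType}.
Local Notation mu := (@lebesgue_measure R).

Definition reducedb (g : mat2 R) : bool :=
  ((Defs.col1 g).1 ^+ 2 + (Defs.col1 g).2 ^+ 2 <= (Defs.col2 g).1 ^+ 2 + (Defs.col2 g).2 ^+ 2) &&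
  (2 * `|(Defs.col1 g).1 * (Defs.col2 g).1 + (Defs.col1 g).2 * (Defs.col2 g).2|
     <= (Defs.col1 g).1 ^+ 2 + (Defs.col1 g).2 ^+ 2).

Lemma reducedE : @reduced R = [set g | reducedb g].
Proof.
by apply/seteqP; split => g; rewrite /reduced /reducedb/= => /andP.
Qed.

Lemma measurable_reducedb : measurable_fun [set: mat2 R] reducedb.
Proof. by rewrite /reducedb /Defs.col1 /Defs.col2; meas. Qed.

(** This choice of b means v2 = x v1 + w / rho with w = (- c, a) orthogonal to v1 and of the same
    length. Hence <v1, v2> = x rho and |v2|^2 = x^2 rho + 1 / rho, so that |v1| <= |v2| reads rho^2
    (1 - x^2) <= 1. *)
Lemma reducedb_slice (a c x : R) : a != 0 ->
  let rho := a ^+ 2 + c ^+ 2 in let b := a * x + - (c / rho) in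
  reducedb ((a, c), (b, (1 + b * c) / a)) =
  (`|x| <= 2^-1) && (rho <= (Num.sqrt (1 - x ^+ 2))^-1).
Proof.
move=> a0 rho b.
have rho0 : 0 < rho by rewrite ltr_pwDl ?sqr_ge0// exprn_even_gt0.
have rhon : rho != 0 by rewrite gt_eqF.
rewrite /reducedb/= -/rho.
have -> : (1 + b * c) / a = x * c + a / rho.
  by rewrite /b /rho; field; rewrite -/rho rhon a0.
have -> : a * b + c * (x * c + a / rho) = x * rho.
  by rewrite /b /rho; field; rewrite -/rho rhon.
have -> : b ^+ 2 + (x * c + a / rho) ^+ 2 = x ^+ 2 * rho + rho^-1.
  by rewrite /b /rho; field; rewrite -/rho rhon.
rewrite andbC normrM (gtr0_norm rho0) mulrA ger_pMl// -ler_pdivlMl// mulr1.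
have [x2|//] := leP `|x| 2^-1; rewrite /=.
have x20 : 0 < 1 - x ^+ 2.
  by rewrite -real_normK ?num_real//; have := normr_ge0 x; nra.
have s0 : 0 < Num.sqrt (1 - x ^+ 2) by rewrite sqrtr_gt0.
have -> : (rho <= (Num.sqrt (1 - x ^+ 2))^-1) = (rho ^+ 2 <= (1 - x ^+ 2)^-1).
  by rewrite -[in RHS](sqr_sqrtr (ltW x20)) -exprVn ler_pXn2r// nnegrE ?invr_ge0; apply: ltW.
have -> : (rho <= x ^+ 2 * rho + rho^-1) = (rho ^+ 2 * (1 - x ^+ 2) <= 1).
  rewrite -[LHS]subr_ge0 -[RHS]subr_ge0.
  have -> : 1 - rho ^+ 2 * (1 - x ^+ 2) = rho * (x ^+ 2 * rho + rho^-1 - rho) by field.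
  by rewrite pmulr_rge0.
by rewrite -div1r ler_pdivlMr.
Qed.

Lemma integral_slice_reducedb (a c : R) : a != 0 ->
  (\int[mu]_b slice_fun reducedb a c b =
   \int[mu]_x ((`|x| <= 2^-1)%R && (a ^+ 2 + c ^+ 2 <= (Num.sqrt (1 - x ^+ 2))^-1)%R)%:R%:E)%E.
Proof.
move=> a0.
rewrite (@ge0_integral_affine R a (- (c / (a ^+ 2 + c ^+ 2))))//; last 2 first.
- by apply: measurable_slice_fun; meas; exact: measurable_reducedb.
- exact: slice_fun_ge0.
rewrite -ge0_integralZl//; last 2 first.
- by apply: measurable_slice_fun; meas; exact: measurable_reducedb.
- by move=> *; exact: slice_fun_ge0.
apply: eq_integral => x _; rewrite /slice_fun reducedb_slice// -EFinM mulrA.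
by rewrite mulfV ?mul1r// normr_eq0.
Qed.

Lemma leb4_cone_reduced : leb4 (cone (@reduced R)) = (pi ^+ 2 / 6)%:E.
Proof.
rewrite reducedE leb4_cone; last exact: measurable_reducedb.
rewrite [X in (_ * X)%E](_ : _ = \int[mu]_a \int[mu]_c \int[mu]_x ((`|x| <= 2^-1)%R && (a ^+ 2 + c ^+ 2 <= (Num.sqrt (1 - x ^+ 2))^-1)%R)%:R%:E)%E; last first.
  apply: integral_neq0.
  - meas; first by apply: measurable_slice_fun; meas; exact: measurable_reducedb.
    + exact: slice_fun_ge0.
    + by apply: integral_ge0 => *; exact: slice_fun_ge0.
  - by meas; nonneg.
  - by move=> *; do 2 (apply: integral_ge0 => ? _); exact: slice_fun_ge0.
  - by move=> *; nonneg.
  move=> a a0; apply: eq_integral => c _; exact: integral_slice_reducedb.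
(* With x moved outermost, the two inner integrals are the area of a disc whose squared radius
   depends on x alone. *)
pose G (x a c : R) : \bar R := ((`|x| <= 2^-1)%R && (a ^+ 2 + c ^+ 2 <= (Num.sqrt (1 - x ^+ 2))^-1)%R)%:R%:E.
have G0 x a c : (0 <= G x a c)%E by rewrite lee_fin.
rewrite [X in (_ * X)%E](_ : _ = \int[mu]_x \int[mu]_a \int[mu]_c G x a c)%E; last first.
  rewrite [RHS](@tonelli R (fun x a => \int[mu]_c G x a c))%E; last 2 first.
  - by rewrite /G; meas; nonneg.
  - by move=> *; exact: integral_ge0.
  apply: eq_integral => a _.
  by rewrite [RHS](@tonelli R (fun x c => G x a c))%E//; rewrite /G; meas.
rewrite [X in (_ * X)%E](_ : _ = \int[mu]_x ((`|x| <= 2^-1)%R%:R * (pi * (Num.sqrt (1 - x ^+ 2))^-1))%R%:E)%E; last first.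
  apply: eq_integral => x _; rewrite /G.
  have [x2|x2] := leP `|x| 2^-1; last first.
    by rewrite mul0r integral0_eq// => a _; rewrite integral0_eq.
  have x20 : 0 < 1 - x ^+ 2.
    by rewrite -real_normK ?num_real//; have := normr_ge0 x; nra.
  by rewrite mul1r disc_area// invr_gt0 sqrtr_gt0.
have PE (x : R) : (`|x| <= 2^-1) = (- 2^-1 <= x <= 2^-1) by rewrite ler_norml.
rewrite (integral_indic_itv _ PE).
under eq_integral do rewrite EFinM.
rewrite ge0_integralZl//.
- by rewrite integral_inv_sqrt -!EFinM; congr EFin; field.
- by apply: measurable_funTS; meas.
- by rewrite lee_fin pi_ge0.
Qed.

End reduced_volume.

(** * Volumes of model regions *)

Section volumes.
Context {R : realType}.
Local Notation mu := (@lebesgue_measure R).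
Implicit Types P Q : mat2 R -> bool.

(** Left multiplication by the rotation (x, y) |-> (- y, x), which is an isometry for both the
    Euclidean and the sup norm. *)
Definition rot2 (g : mat2 R) : mat2 R := ((- g.1.2, g.1.1), (- g.2.2, g.2.1)).

Lemma measurable_rot2 P : measurable_fun [set: mat2 R] P ->
  measurable_fun [set: mat2 R] (fun g => P (rot2 g)).
Proof. by move=> mP; apply: (measurableT_comp mP); rewrite /rot2; meas. Qed.

Lemma integral_rot2 (f : R -> R -> \bar R) :
  measurable_fun [set: R * R] (fun z => f z.1 z.2) -> (forall x y, 0 <= f x y)%E ->
  (\int[mu]_a \int[mu]_c f (- c)%R a = \int[mu]_a \int[mu]_c f a c)%E.
Proof.
move=> mf f0.
have mfN : measurable_fun [set: R * R] (fun z => f (- z.2)%R z.1).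
  by apply: (@measurableT_comp _ _ _ _ _ _ _ _ (fun z : R * R => (- z.2, z.1)%R) mf); meas.
rewrite (tonelli mfN (fun a c => f0 (- c) a)).
rewrite [RHS](@ge0_integral_affine R (-1) 0)//.
- rewrite normrN normr1 mul1e.
  by apply: eq_integral => c _; rewrite addr0 mulN1r.
- by apply: measurable_integral.
- by move=> x; apply: integral_ge0.
Qed.

Lemma leb4_rot2 Q : measurable_fun [set: mat2 R] Q ->
  leb4 [set M | Q (rot2 M)] = leb4 [set M | Q M].
Proof.
move=> mQ; rewrite (leb4_boolset (measurable_rot2 mQ)) (leb4_boolset mQ).
have mF d (T : measurableType d) (f g h k : T -> R) :
    measurable_fun [set: T] f -> measurable_fun [set: T] g ->
    measurable_fun [set: T] h -> measurable_fun [set: T] k ->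
    measurable_fun [set: T] (fun x => (Q ((f x, g x), (h x, k x)))%:R%:E : \bar R).
  by move=> mf mg mh mk; meas; apply: (measurableT_comp mQ); meas.
transitivity (\int[mu]_a \int[mu]_c \int[mu]_b \int[mu]_d ((Q ((- c, a), (b, d)))%R%:R)%:E)%E.
  apply: eq_integral => a _; apply: eq_integral => c _.
  rewrite -[RHS](@integral_rot2 (fun b d => ((Q ((- c, a), (b, d)))%R%:R)%:E))//.
  by apply: mF; meas.
apply: (@integral_rot2 (fun a c => \int[mu]_b \int[mu]_d ((Q ((a, c), (b, d)))%:R)%:E)%E).
- by meas; [apply: (measurableT_comp mQ); meas|nonneg..].
- by move=> *; nonneg.
Qed.

Lemma det2_rot2 (g : mat2 R) : det2 (rot2 g) = det2 g.
Proof. by rewrite /det2 /rot2 /=; ring. Qed.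

Lemma normalize_rot2 (M : mat2 R) : normalize (rot2 M) = rot2 (normalize M).
Proof. by rewrite /normalize det2_rot2 /rot2/= !mulNr. Qed.

Lemma cone_boolset P :
  cone [set g | P g] = [set M | (0 < det2 M <= 1) && P (normalize M)].
Proof. by apply/seteqP; split => M; rewrite /cone /= => /andP. Qed.

Lemma measurable_cone_boolset P : measurable_fun [set: mat2 R] P ->
  measurable_fun [set: mat2 R] (fun M : mat2 R => (0 < det2 M <= 1) && P (normalize M)).
Proof.
move=> mP; rewrite /det2 /Defs.col1 /Defs.col2; meas.
by apply: (measurableT_comp mP); rewrite /normalize /det2 /Defs.col1 /Defs.col2; meas.
Qed.

Lemma leb4_cone_rot2 P : measurable_fun [set: mat2 R] P ->
  leb4 (cone [set g | P (rot2 g)]) = leb4 (cone [set g | P g]).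
Proof.
move=> mP; rewrite !cone_boolset -[RHS]leb4_rot2; last exact: measurable_cone_boolset.
congr leb4; apply/seteqP; split => M; rewrite /= det2_rot2 normalize_rot2//.
Qed.

Lemma det2_normalize (M : mat2 R) : 0 < det2 M -> det2 (normalize M) = 1.
Proof.
move=> d0.
have s0 : 0 < Num.sqrt (det2 M) by rewrite sqrtr_gt0.
have ss : Num.sqrt (det2 M) ^+ 2 = det2 M by rewrite sqr_sqrtr// ltW.
rewrite /normalize {1}/det2/=; set s := Num.sqrt _.
transitivity (det2 M / s ^+ 2); last by rewrite /s ss divff// gt_eqF.
by rewrite /det2; field; rewrite gt_eqF.
Qed.

(** Every point of a cone normalises to determinant 1, so inclusions need checking only there. The
    set [A] may be arbitrary because [leb4] is monotone on all sets. *)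
Lemma leb4_cone_le P (A : set (mat2 R)) :
  (forall g, det2 g = 1 -> A g -> P g) -> (leb4 (cone A) <= leb4 (cone [set g | P g]))%E.
Proof.
move=> AP; apply: le_leb4 => M [/andP[d0 d1] AM]; split; first by rewrite d0.
by apply: AP => //; exact: det2_normalize.
Qed.

Lemma leb4_cone_ge P (A : set (mat2 R)) :
  (forall g, det2 g = 1 -> P g -> A g) -> (leb4 (cone [set g | P g]) <= leb4 (cone A))%E.
Proof.
move=> AP; apply: le_leb4 => M [/andP[d0 d1] AM]; split; first by rewrite d0.
by apply: AP => //; exact: det2_normalize.
Qed.

Lemma integral3D (f g : R -> R -> R -> \bar R) :
  measurable_fun [set: (R * R) * R] (fun z => f z.1.1 z.1.2 z.2) ->
  measurable_fun [set: (R * R) * R] (fun z => g z.1.1 z.1.2 z.2) ->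
  (forall x y z, 0 <= f x y z)%E -> (forall x y z, 0 <= g x y z)%E ->
  (\int[mu]_a \int[mu]_c \int[mu]_b (f a c b + g a c b) =
   \int[mu]_a \int[mu]_c \int[mu]_b f a c b +
   \int[mu]_a \int[mu]_c \int[mu]_b g a c b)%E.
Proof.
move=> mf mg f0 g0.
have m1 (h : R -> R -> R -> \bar R) a c :
    measurable_fun [set: (R * R) * R] (fun z => h z.1.1 z.1.2 z.2) ->
    measurable_fun [set: R] (fun b => h a c b).
  move=> mh.
  by apply: (@measurableT_comp _ _ _ _ _ _ _ _ (fun b : R => ((a, c), b)) mh); meas.
have m2 (h : R -> R -> R -> \bar R) a : (forall x y z, 0 <= h x y z)%E ->
    measurable_fun [set: (R * R) * R] (fun z => h z.1.1 z.1.2 z.2) ->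
    measurable_fun [set: R] (fun c => \int[mu]_b h a c b)%E.
  move=> h0 mh; apply: measurable_integral => //.
  by apply: (@measurableT_comp _ _ _ _ _ _ _ _ (fun z : R * R => ((a, z.1), z.2)) mh); meas.
have m3 (h : R -> R -> R -> \bar R) : (forall x y z, 0 <= h x y z)%E ->
    measurable_fun [set: (R * R) * R] (fun z => h z.1.1 z.1.2 z.2) ->
    measurable_fun [set: R] (fun a => \int[mu]_c \int[mu]_b h a c b)%E.
  move=> h0 mh; apply: measurable_integral.
    exact: (@measurable_integral R _ _ (fun w b => h w.1 w.2 b)).
  by move=> *; exact: integral_ge0.
rewrite -ge0_integralD//.
- apply: eq_integral => a _; rewrite -ge0_integralD//.
  + by apply: eq_integral => c _; rewrite ge0_integralD//; exact: m1.
  + by move=> *; exact: integral_ge0.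
  + exact: m2.
  + by move=> *; exact: integral_ge0.
  + exact: m2.
- by move=> *; apply: integral_ge0 => *; exact: integral_ge0.
- exact: m3.
- by move=> *; apply: integral_ge0 => *; exact: integral_ge0.
- exact: m3.
Qed.

Lemma slice3_ge0 P : (0 <= \int[mu]_a \int[mu]_c \int[mu]_b slice_fun P a c b)%E.
Proof. by do 3 (apply: integral_ge0 => ? _); exact: slice_fun_ge0. Qed.

Lemma leb4_cone_or P Q : measurable_fun [set: mat2 R] P -> measurable_fun [set: mat2 R] Q ->
  (leb4 (cone [set g | P g || Q g]) <= leb4 (cone [set g | P g]) + leb4 (cone [set g | Q g]))%E.
Proof.
move=> mP mQ.
have mPQ : measurable_fun [set: mat2 R] (fun g => P g || Q g) by exact: measurable_or.
rewrite (leb4_cone mP) (leb4_cone mQ) (leb4_cone mPQ).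
rewrite -ge0_muleDr ?slice3_ge0//.
rewrite -integral3D; last 4 first.
- by apply: measurable_slice_fun => //; meas.
- by apply: measurable_slice_fun => //; meas.
- by move=> *; exact: slice_fun_ge0.
- by move=> *; exact: slice_fun_ge0.
apply: lee_wpmul2l; first by rewrite lee_fin invr_ge0.
apply: le_integral_nonmeas => a.
  by do 2 (apply: integral_ge0 => ? _); exact: slice_fun_ge0.
apply: le_integral_nonmeas => c.
  by apply: integral_ge0 => ? _; exact: slice_fun_ge0.
apply: le_integral_nonmeas => b; first exact: slice_fun_ge0.
rewrite -EFinD lee_fin -mulrDr ler_wpM2l ?invr_ge0//.
by case: (P _) => /=; rewrite ?lerDl// add0r.
Qed.

Lemma leb4_cone_or_disj P Q : measurable_fun [set: mat2 R] P -> measurable_fun [set: mat2 R] Q ->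
  (forall g, P g -> Q g -> False) ->
  (leb4 (cone [set g | P g || Q g]) = leb4 (cone [set g | P g]) + leb4 (cone [set g | Q g]))%E.
Proof.
move=> mP mQ PQ.
have mPQ : measurable_fun [set: mat2 R] (fun g => P g || Q g) by exact: measurable_or.
rewrite (leb4_cone mP) (leb4_cone mQ) (leb4_cone mPQ).
rewrite -ge0_muleDr ?slice3_ge0//.
rewrite -integral3D; last 4 first.
- by apply: measurable_slice_fun => //; meas.
- by apply: measurable_slice_fun => //; meas.
- by move=> *; exact: slice_fun_ge0.
- by move=> *; exact: slice_fun_ge0.
rewrite [X in (_ * X = _)%E](_ : _ = \int[mu]_a \int[mu]_c \int[mu]_b (slice_fun P a c b + slice_fun Q a c b))%E; first reflexivity.
apply: eq_integral => a _; apply: eq_integral => c _; apply: eq_integral => b _.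
rewrite -EFinD -mulrDr /slice_fun; congr (_ * _)%:E.
by move: (PQ (a, c, (b, (1 + b * c) / a))); case: (P _); case: (Q _) => //= h; rewrite ?addr0 ?add0r//; have := h isT isT.
Qed.

End volumes.

(** * Boxes and hyperbolic regions *)

Section regions.
Context {R : realType}.
Local Notation mu := (@lebesgue_measure R).

Lemma integral_itv_cst (u v k : R) : u <= v ->
  (\int[mu]_(x in `[u, v]) k%:E = (k * (v - u))%:E)%E.
Proof.
move=> uv; rewrite integral_cst//= lebesgue_measure_itv/= lte_fin.
move: uv; rewrite le_eqVlt => /predU1P[->|uv]; last by rewrite uv -EFinB -EFinM.
by rewrite ltxx subrr mulr0 mule0.
Qed.

Lemma integral_abs_le (beta k : R) : 0 <= beta ->
  (\int[mu]_x ((`|x| <= beta)%R%:R * k)%R%:E = (2 * beta * k)%:E)%E.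
Proof.
move=> b0; rewrite (@integral_indic_itv _ _ (- beta) beta (fun=> k)).
  by rewrite integral_itv_cst; [congr EFin; ring|rewrite ge0_cp].
by move=> x; rewrite ler_norml.
Qed.

Lemma integral_abs_itv (u v : R) (g : R -> R) : 0 < u ->
  measurable_fun [set: R] g -> (forall x : R, 0 <= g `|x|) ->
  (\int[mu]_x ((u <= `|x| <= v)%R%:R * g `|x|)%R%:E = 2%:E * \int[mu]_(x in `[u, v]) (g x)%:E)%E.
Proof.
move=> u0 mg g0.
rewrite ge0_integral_even; last 3 first.
- by meas; apply: (measurableT_comp mg); meas.
- by move=> x; rewrite lee_fin mulr_ge0.
- by move=> x; rewrite normrN.
have PE (x : R) : (0 <= x) && (u <= `|x| <= v) = (u <= x <= v).
  have [x0|x0] := leP 0 x; first by rewrite ger0_norm.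
  by symmetry; apply/negbTE; rewrite negb_and -ltNge (lt_trans x0).
rewrite -(integral_indic_itv _ PE); congr (_%:E * _)%E; apply: eq_integral => x _.
rewrite -EFinM mulrA; have [x0|x0] := leP 0 x; last by rewrite !mul0r.
by rewrite ger0_norm// mul1r.
Qed.

Definition box (q q' beta gamma : R) (g : mat2 R) : bool :=
  [&& q <= `|g.1.1| <= q', `|g.1.2| <= gamma & `|g.2.1| <= beta].

Lemma measurable_box q q' beta gamma : measurable_fun [set: mat2 R] (box q q' beta gamma).
Proof. by rewrite /box; meas. Qed.

(** On the box 1/|a| <= 1/q <= 2. With the factor 1/2 of [leb4_cone] and a factor 2 for the signs of
    each of a, b, c, the constant is 8. *)
Lemma leb4_cone_box (q q' beta gamma : R) :
  2^-1 <= q -> q <= q' -> 0 <= beta -> 0 <= gamma ->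
  (leb4 (cone [set g | box q q' beta gamma g]) <= (8 * (q' - q) * beta * gamma)%:E)%E.
Proof.
move=> q2 qq' b0 c0.
have q0 : 0 < q by apply: lt_le_trans q2.
rewrite (leb4_cone (measurable_box q q' beta gamma)).
have -> : (8 * (q' - q) * beta * gamma)%:E = ((2^-1)%:E * (16 * (q' - q) * beta * gamma)%:E)%E.
  by rewrite -EFinM; congr EFin; field.
apply: lee_wpmul2l; first by rewrite lee_fin invr_ge0.
apply: (@le_trans _ _ (\int[mu]_a \int[mu]_c \int[mu]_b
   ((`|b| <= beta)%R%:R * ((`|c| <= gamma)%R%:R * ((q <= `|a| <= q')%R%:R * 2)))%R%:E)%E).
  apply: le_integral_nonmeas => a.
    by do 2 (apply: integral_ge0 => ? _); exact: slice_fun_ge0.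
  apply: le_integral_nonmeas => c.
    by apply: integral_ge0 => ? _; exact: slice_fun_ge0.
  apply: le_integral_nonmeas => b; first exact: slice_fun_ge0.
  rewrite lee_fin /box /=.
  have [/andP[qa aq]|_] := boolP (q <= `|a| <= q'); last by rewrite mulr0 mul0r !mulr0.
  case: (`|c| <= gamma); case: (`|b| <= beta); rewrite /= ?mulr0 ?mul0r ?mulr0 ?mul1r ?mulr1//.
  by rewrite -[leRHS]invrK lef_pV2 ?posrE ?invr_gt0//; [exact: le_trans qa|exact: lt_le_trans qa].
rewrite le_eqVlt; apply/orP; left; apply/eqP.
transitivity (\int[mu]_a \int[mu]_c
   ((`|c| <= gamma)%R%:R * ((q <= `|a| <= q')%R%:R * (4 * beta)))%R%:E)%E.
  apply: eq_integral => a _; apply: eq_integral => c _.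
  by rewrite integral_abs_le//; congr EFin; ring.
transitivity (\int[mu]_a ((q <= `|a| <= q')%R%:R * (8 * beta * gamma))%R%:E)%E.
  by apply: eq_integral => a _; rewrite integral_abs_le//; congr EFin; ring.
rewrite (@integral_abs_itv q q' (fun=> 8 * beta * gamma))//.
- by rewrite integral_itv_cst// -EFinM; congr EFin; ring.
- by move=> _; rewrite !mulr_ge0.
Qed.

(* As d = (1 + b c) / a on the slice, the last two conditions say that |d| >= q. *)
Definition hyp (q s B : R) (g : mat2 R) : bool :=
  [&& q <= `|g.1.1|, s <= `|g.2.1| <= B, g.2.1 * g.1.2 <= 0 &
      `|g.2.1| * `|g.1.2| <= 1 - q * `|g.1.1|].

Lemma measurable_hyp q s B : measurable_fun [set: mat2 R] (hyp q s B).
Proof. by rewrite /hyp; meas. Qed.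

(** The admissible c form an interval of length k / |b| with an endpoint at 0, on the side opposite
    to the sign of b. *)
Lemma integral_hyp_c (b k : R) : b != 0 -> 0 <= k ->
  (\int[mu]_c ((b * c <= 0)%R && (`|b| * `|c| <= k)%R)%:R%:E = (k / `|b|)%:E)%E.
Proof.
move=> b0 k0.
have [bp|bn|be] := ltgtP 0 b; last by rewrite -be eqxx in b0.
- have PE (c : R) : (b * c <= 0) && (`|b| * `|c| <= k) = (- (k / b) <= c <= 0).
    rewrite pmulr_rle0// gtr0_norm// andbC; have [c0|] := leP c 0; last by rewrite !andbF.
    by rewrite !andbT ler0_norm// [RHS]lerNl ler_pdivlMr// mulrC.
  under eq_integral do rewrite -[X in X%:E]mulr1.
  rewrite (@integral_indic_itv _ _ _ _ (fun=> 1) PE) integral_itv_cst.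
    by rewrite mul1r sub0r opprK gtr0_norm.
  by rewrite oppr_le0 divr_ge0// ltW.
- have PE (c : R) : (b * c <= 0) && (`|b| * `|c| <= k) = (0 <= c <= - (k / b)).
    rewrite nmulr_rle0// ltr0_norm//; have [c0|//] := leP 0 c.
    by rewrite /= ger0_norm// -mulrN -invrN ler_pdivlMr ?oppr_gt0// mulrC.
  under eq_integral do rewrite -[X in X%:E]mulr1.
  rewrite (@integral_indic_itv _ _ _ _ (fun=> 1) PE) integral_itv_cst.
    by rewrite mul1r subr0 ltr0_norm// invrN mulrN.
  by rewrite -mulrN -invrN divr_ge0// oppr_ge0 ltW.
Qed.

Lemma integral_inv_itv (s B : R) : 0 < s -> s < B ->
  (\int[mu]_(x in `[s, B]) (x^-1)%:E = (ln B - ln s)%:E)%E.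
Proof.
move=> s0 sB; apply: (@FTC2_is_derive R (@GRing.inv R) (@ln R)) => //.
- by move=> x /andP[sx _]; apply: is_derive1_ln; exact: lt_le_trans sx.
- by move=> x /andP[sx _]; apply: inv_continuous; rewrite gt_eqF// (lt_le_trans s0).
Qed.

(** Integrating over c gives (1 - q |a|) / |b|, and over b then 2 (ln B - ln s) (1 - q |a|). The
    density 1/|a| lies between q and 1/q where q <= |a| <= 1/q, and the integral of 1 - q x over
    [q, 1/q] is (1 - q^2)^2 / (2 q). *)
Lemma leb4_cone_hyp (q s B : R) : 0 < q -> q < 1 -> 0 < s -> s < B ->
  (((ln B - ln s) * (1 - q ^+ 2) ^+ 2)%:E <= leb4 (cone [set g | hyp q s B g]) <=
   ((ln B - ln s) * ((1 - q ^+ 2) ^+ 2 / q ^+ 2))%:E)%E.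
Proof.
move=> q0 q1 s0 sB.
have B0 : 0 < B by exact: lt_trans sB.
have L0 : 0 <= ln B - ln s by rewrite subr_ge0 ler_ln ?posrE// ltW.
(* The maximum with 0 keeps the integrand nonnegative beyond 1/q, where the region is empty. *)
pose w (x : R) : R := x^-1 * Num.max 0 (1 - q * x).
have w0 (x : R) : 0 <= w `|x| by rewrite mulr_ge0 ?invr_ge0// le_max lexx.
have mw : measurable_fun [set: R] w.
  by rewrite /w; meas; apply: measurable_maxr; meas.
have qV : q < q^-1 by rewrite -div1r ltr_pdivlMr//; nra.
have -> : leb4 (cone [set g | hyp q s B g]) =
    ((ln B - ln s)%:E * (2%:E * \int[mu]_(x in `[q, (q^-1)%R]) (w x)%:E))%E.
  rewrite (leb4_cone (measurable_hyp q s B)).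
  have E (a : R) : (\int[mu]_c \int[mu]_b slice_fun (hyp q s B) a c b =
     (2 * (ln B - ln s))%:E * ((q <= `|a| <= q^-1)%R%:R * w `|a|)%R%:E)%E.
    rewrite (@tonelli R (fun c b => slice_fun (hyp q s B) a c b)); last 2 first.
    - by apply: measurable_slice_fun; meas; exact: measurable_hyp.
    - by move=> *; exact: slice_fun_ge0.
    transitivity (\int[mu]_b (((q <= `|a| <= q^-1)%R%:R * w `|a|)%R%:E * ((s <= `|b| <= B)%R%:R * `|b|^-1)%R%:E))%E.
      apply: eq_integral => b _.
      have [sb|sb] := boolP (s <= `|b| <= B); last first.
        rewrite mul0r mule0 integral0_eq// => c _.
        by rewrite /slice_fun /hyp/= (negbTE sb)/= andbF mulr0.
      have [qa|qa] := boolP (q <= `|a| <= q^-1); last first.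
        rewrite mul0r mul0e integral0_eq// => c _.
        rewrite /slice_fun /hyp/= sb/=; case: (leP q `|a|) => /= [qa1|_]; last by rewrite mulr0.
        move: qa; rewrite qa1/= -ltNge => qa.
        have : 1 - q * `|a| < 0 by rewrite subr_lt0 -ltr_pdivrMl// mulr1.
        move=> h; rewrite [X in _ && X](_ : _ = false) ?andbF ?mulr0//.
        by apply/negbTE; rewrite -ltNge (lt_le_trans h)// mulr_ge0.
      move: qa => /andP[qa1 qa2].
      have k0 : 0 <= 1 - q * `|a| by rewrite subr_ge0 -ler_pdivlMl// mulr1.
      have b0 : b != 0 by rewrite -normr_gt0; case/andP: sb => sb _; exact: lt_le_trans sb.
      transitivity (\int[mu]_c ((`|a|^-1)%:E * ((b * c <= 0)%R && (`|b| * `|c| <= 1 - q * `|a|)%R)%:R%:E))%E.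
        by apply: eq_integral => c _; rewrite /slice_fun /hyp/= qa1 sb/= EFinM.
      rewrite ge0_integralZl//; last by meas.
      rewrite integral_hyp_c// !mul1r -!EFinM; congr EFin.
      by rewrite /w max_r// mulrA.
    rewrite ge0_integralZl//; [|first [by meas|by move=> *; rewrite lee_fin mulr_ge0 ?invr_ge0]..].
    rewrite (@integral_abs_itv s B (@GRing.inv R))//; last exact: inv_measurable.
    by rewrite integral_inv_itv// -EFinM muleC.
  under eq_integral do rewrite E.
  rewrite ge0_integralZl//; [|first [by meas; apply: (measurableT_comp mw); meas|by move=> *; rewrite lee_fin mulr_ge0]..].
  rewrite (integral_abs_itv _ q0 mw w0) muleA -EFinM.
  by rewrite [(2^-1 * _)%R](_ : _ = ln B - ln s)//; field.
have I (k : R) : (\int[mu]_(x in `[q, (q^-1)%R]) (k * (1 - q * x))%:E = (k * ((1 - q ^+ 2) ^+ 2 / (2 * q)))%:E)%E.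
  apply: etrans; first apply: (@FTC2_is_derive R (fun x => k * (1 - q * x)) (fun x : R => k * (x - q * x ^+ 2 / 2))) => //.
  - by move=> x _; apply: is_derive_eq; rewrite /GRing.scale/=; field.
  - move=> x _; apply: cvgM; first exact: cvg_cst.
    apply: cvgB; first exact: cvg_cst.
    by apply: cvgM; [exact: cvg_cst|exact: cvg_id].
  by congr EFin; field; rewrite gt_eqF.
have wE x : q <= x <= q^-1 -> [/\ 0 <= q * (1 - q * x), q * (1 - q * x) <= w x & w x <= q^-1 * (1 - q * x)].
  move=> /andP[qx xq].
  have x0 : 0 < x by exact: lt_le_trans qx.
  have k0 : 0 <= 1 - q * x by rewrite subr_ge0 -ler_pdivlMl// mulr1.
  rewrite /w max_r//; split.
  - by rewrite mulr_ge0// ltW.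
  - by apply: ler_wpM2r => //; rewrite -[leLHS]invrK lef_pV2 ?posrE ?invr_gt0.
  - by apply: ler_wpM2r => //; rewrite lef_pV2 ?posrE.
have mk (k : R) : measurable_fun `[q, q^-1] (fun x : R => (k * (1 - q * x))%:E).
  by apply: measurable_funTS; meas.
have mw' : measurable_fun `[q, q^-1] (fun x : R => (w x)%:E).
  by apply: measurable_funTS; apply/measurable_EFinP.
apply/andP; split.
- have -> : ((ln B - ln s) * (1 - q ^+ 2) ^+ 2)%:E = ((ln B - ln s)%:E * (2%:E * (q * ((1 - q ^+ 2) ^+ 2 / (2 * q)))%:E))%E.
    by rewrite -!EFinM; congr EFin; field; rewrite gt_eqF.
  rewrite -I; apply: lee_wpmul2l; first by rewrite lee_fin.
  apply: lee_wpmul2l; first by rewrite lee_fin.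
  apply: ge0_le_integral; [by []| | exact: mk | exact: mw' |].
  + by move=> x; rewrite /= in_itv/= => /wE[]; rewrite lee_fin.
  + by move=> x; rewrite /= in_itv/= => /wE[]; rewrite lee_fin.
- have -> : ((ln B - ln s) * ((1 - q ^+ 2) ^+ 2 / q ^+ 2))%:E = ((ln B - ln s)%:E * (2%:E * (q^-1 * ((1 - q ^+ 2) ^+ 2 / (2 * q)))%:E))%E.
    by rewrite -!EFinM; congr EFin; field; rewrite gt_eqF.
  rewrite -I; apply: lee_wpmul2l; first by rewrite lee_fin.
  apply: lee_wpmul2l; first by rewrite lee_fin.
  apply: ge0_le_integral; [by []| | exact: mw' | exact: mk |].
  + by move=> x; rewrite /= in_itv/= => /wE[] *; rewrite lee_fin; lra.
  + by move=> x; rewrite /= in_itv/= => /wE[]; rewrite lee_fin.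
Qed.

End regions.

(** * Near-critical lattices *)

Section inclusions.
Context {R : realType}.
Implicit Types (q r t a b c d : R).

(* No vector among v1, v2, v2 - v1, v2 + v1 has sup norm less than q. *)
Definition shortfree q a b c d : bool :=
  [&& (q <= `|a|) || (q <= `|c|), (q <= `|b|) || (q <= `|d|),
      (q <= `|b - a|) || (q <= `|d - c|) & (q <= `|b + a|) || (q <= `|d + c|)].

(** Used with t = sqrt r. The first box takes the bases with b c <= 0 and |b| < t, which [hyp]
    misses; the other two serve [outer_pos], where c or b is O(r). Each box has volume O(r^2). *)
Definition outer q r t (g : mat2 R) : bool :=
  [|| hyp q t 1 g, box q (q + 4 * r) t (3 * t) g, box q (q + 4 * r) 1 (5 * r) g |
      box q (q + 4 * r) (4 * r) 1 g].

Lemma sqr_le_bounds (x y : R) : 0 <= y -> x ^+ 2 <= y ^+ 2 -> - y <= x /\ x <= y.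
Proof.
move=> y0; rewrite -[x ^+ 2]real_normK ?num_real// ler_pXn2r ?nnegrE//.
by rewrite ler_norml => /andP[].
Qed.

(** Put rho = |v1|^2. Lagrange's identity |v1|^2 |v2|^2 = <v1, v2>^2 + 1 and reducedness give rho^2
    <= rho^2 / 4 + 1, so rho^2 <= 4/3 < (7/6)^2. *)
Lemma reducedb_sq_bound a b c d : 99 / 100 <= a ^+ 2 ->
  a * d - b * c = 1 -> reducedb ((a, c), (b, d)) ->
  [/\ 0 < a ^+ 2 + c ^+ 2, a ^+ 2 + c ^+ 2 <= 7 / 6 &
      `|a * b + c * d| <= (a ^+ 2 + c ^+ 2) / 2].
Proof.
move=> a2 det /andP[/= v12 X2].
have rhoE : (a ^+ 2 + c ^+ 2) * (b ^+ 2 + d ^+ 2) = (a * b + c * d) ^+ 2 + 1.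
  by rewrite -(expr1n _ 2) -det; ring.
have rho99 : 99 / 100 <= a ^+ 2 + c ^+ 2 by apply: (le_trans a2); rewrite lerDl sqr_ge0.
move: v12 X2 rhoE rho99; move: (a ^+ 2 + c ^+ 2) (b ^+ 2 + d ^+ 2) (a * b + c * d) => rho v X.
move=> {a2 det} v12 X2 rhoE rho99.
have rho0 : 0 < rho by lra.
have X1 : `|X| <= rho / 2 by lra.
split => //.
have h1 : rho ^+ 2 <= rho * v by rewrite expr2 ler_pM2l.
have h2 : X ^+ 2 <= (rho / 2) ^+ 2.
  by rewrite -real_normK ?num_real// ler_pXn2r ?nnegrE//; lra.
suff [_ h] : - (7 / 6) <= rho /\ rho <= 7 / 6 by [].
by apply: sqr_le_bounds; [lra|rewrite rhoE in h1; clear -h1 h2; lra].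
Qed.

(** The bound rho <= 7/6 on rho = a^2 + c^2 controls a, and c^2 <= 7/6 - 99/100 < (3/7)^2. With X =
    <v1, v2>, solving for v2 gives rho b = X a - c and rho d = X c + a; the other bounds follow from
    |X| <= rho / 2. *)
Lemma reducedb_bounds a b c d : 0 < a -> 99 / 100 <= a ^+ 2 ->
  a * d - b * c = 1 -> reducedb ((a, c), (b, d)) ->
  [/\ a <= 13 / 12, - (3 / 7) <= c, c <= 3 / 7, b <= 39 / 40 &
      0 < d /\ (0 < c -> b <= 13 / 24)].
Proof.
move=> a0 a2 det red; have [rho0 rho1 X1] := reducedb_sq_bound a2 det red.
have rb : (a ^+ 2 + c ^+ 2) * b = (a * b + c * d) * a - c.
  have : (a * b + c * d) * a - (a * d - b * c) * c = (a ^+ 2 + c ^+ 2) * b by ring.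
  by rewrite det mul1r.
have rd : (a ^+ 2 + c ^+ 2) * d = (a * b + c * d) * c + a.
  have : (a * b + c * d) * c + (a * d - b * c) * a = (a ^+ 2 + c ^+ 2) * d by ring.
  by rewrite det mul1r.
have cc := sqr_ge0 c.
have [c41' c41] : - (3 / 7) <= c /\ c <= 3 / 7.
  by apply: sqr_le_bounds; clear -rho1 a2; lra.
have [_ a1] : - (13 / 12) <= a /\ a <= 13 / 12.
  by apply: sqr_le_bounds; clear -rho1 cc; lra.
have a99 : 9 / 10 <= a.
  by rewrite leNgt; apply/negP => h; have : a ^+ 2 <= (9 / 10) ^+ 2; [rewrite ler_pXn2r ?nnegrE//; lra|clear -a2; lra].
have rho99 : 99 / 100 <= a ^+ 2 + c ^+ 2 by clear -a2 cc; lra.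
move: rho0 rho1 rho99 X1 rb rd.
move: (a ^+ 2 + c ^+ 2) (a * b + c * d) => rho X rho0 rho1 rho99 X1 rb rd.
move: (X1); rewrite ler_norml => /andP[_ X2].
have Xa : X * a <= rho / 2 * (13 / 12).
  have h1 : X * a <= rho / 2 * a by rewrite ler_pM2r.
  apply: (le_trans h1); rewrite ler_pM2l//; clear -rho0; lra.
split => //; last split.
- by rewrite -(ler_pM2l rho0) rb; clear -Xa c41' rho99; lra.
- have : `|X * c| <= rho / 2 * (3 / 7).
    by rewrite normrM ler_pM// ler_norml c41' c41.
  rewrite ler_norml => /andP[h _].
  by rewrite -(pmulr_rgt0 _ rho0) rd; clear -h a99 rho1; lra.
- move=> c0; rewrite -(ler_pM2l rho0) rb; clear -c0 Xa rho0; lra.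
Qed.

Lemma excess_le q r x : 99 / 100 <= q -> 0 <= x - q -> (x - q) * q <= 2 * r ->
  x - q <= 21 / 10 * r.
Proof.
move=> q99 xq h.
have : 0 <= (x - q) * (q - 99 / 100) by rewrite mulr_ge0// subr_ge0.
by lra.
Qed.

(** Here b |c| = 1 - a d <= 1 - q a, so the basis lies in [hyp] as soon as b >= t. Otherwise a d <=
    1 forces a and d to exceed q by O(r), and c^2 <= b^2 + d^2 - a^2 is at most 9 r. *)
Lemma outer_nonpos q r t a b c d :
  0 < t -> r = t ^+ 2 -> r <= 200^-1 -> q < 1 -> 99 / 100 <= q -> 1 - q ^+ 2 <= 2 * r ->
  a * d - b * c = 1 -> a ^+ 2 + c ^+ 2 <= b ^+ 2 + d ^+ 2 ->
  q <= a -> q <= d -> 0 <= b -> b <= 1 -> c <= 0 ->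
  hyp q t 1 ((a, c), (b, d)) || box q (q + 4 * r) t (3 * t) ((a, c), (b, d)).
Proof.
move=> t0 rt r200 q1 q99 kappa det v12 aq dq b0 b1 c0.
have q0 : 0 < q by clear -q99; lra.
have r0 : 0 < r by rewrite rt exprn_gt0.
have a0 : 0 < a by exact: lt_le_trans aq.
have d0 : 0 < d by exact: lt_le_trans dq.
rewrite /hyp /box /= (gtr0_norm a0) (ger0_norm b0) (ler0_norm c0) aq b1 /=.
rewrite mulr_ge0_le0//= andbT.
have bc0 : 0 <= b * - c by rewrite mulr_ge0// oppr_ge0.
have aqd : 0 <= a * (d - q) by rewrite mulr_ge0 ?subr_ge0// ltW.
have dqa : 0 <= d * (a - q) by rewrite mulr_ge0 ?subr_ge0// ltW.
have bc : b * - c <= 1 - q * a by clear -det aqd; lra.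
have aq2 : a - q <= 21 / 10 * r.
  by apply: excess_le => //; [rewrite subr_ge0|clear -bc bc0 kappa; lra].
have dq2 : d - q <= 21 / 10 * r.
  by apply: excess_le => //; [rewrite subr_ge0|clear -det bc0 dqa kappa; lra].
rewrite bc andbT; have [//|bt] := leP t b.
apply/and3P; split; [by clear -aq2 r0; lra| |exact: ltW].
suff [h1 _] : - (3 * t) <= c /\ c <= 3 * t by rewrite lerNl.
apply: sqr_le_bounds; first by clear -t0; lra.
have h2 : d ^+ 2 <= (q + 21 / 10 * r) ^+ 2.
  by rewrite ler_pXn2r ?nnegrE//; clear -dq2 d0 q0 r0; lra.
have h3 : b ^+ 2 <= r by rewrite rt ler_pXn2r ?nnegrE// ltW.
have h4 : q * r <= r by rewrite ger_pMl// ltW.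
have h5 : r * r <= 200^-1 * r by rewrite ler_pM2r.
have h6 : q ^+ 2 <= a ^+ 2 by rewrite ler_pXn2r ?nnegrE// ltW.
by rewrite exprMn -rt; clear -h2 h3 h4 h5 h6 v12 r0; lra.
Qed.

Lemma outer_pos q r t a b c d :
  99 / 100 <= q -> 0 < r -> 1 - q ^+ 2 <= 2 * r ->
  a * d - b * c = 1 -> q <= a -> q <= d -> a <= 13 / 12 ->
  0 <= b -> b <= 13 / 24 -> 0 < c -> c <= 3 / 7 ->
  (q <= `|b - a|) || (q <= `|d - c|) ->
  box q (q + 4 * r) 1 (5 * r) ((a, c), (b, d)) ||
  box q (q + 4 * r) (4 * r) 1 ((a, c), (b, d)).
Proof.
move=> q99 r0 kappa det aq dq a1 b0 b2 c0 c41 s3.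
have q0 : 0 < q by clear -q99; lra.
have a0 : 0 < a by exact: lt_le_trans aq.
rewrite /box /= (gtr0_norm a0) (ger0_norm b0) (gtr0_norm c0) aq /=.
have bd0 : 0 <= (a - q) * (d - q) by rewrite mulr_ge0// subr_ge0.
have k1 : 0 <= (a - q) * (q - 99 / 100) by rewrite mulr_ge0// subr_ge0.
have k2 : 0 <= q * (d - q) by rewrite mulr_ge0 ?subr_ge0// ltW.
(* Case a - b >= q: then b <= a - q, so a d - 1 = b c <= (a - q) c <= 3/7 (a - q). As d >= q, this
   gives (a - q) (q - 3/7) <= 2 r, and q - 3/7 > 56/100. *)
case/orP: s3 => s3.
  have ab : 0 <= a - q - b.
    by move: s3; rewrite distrC ger0_norm; clear -b2 aq q99; lra.
  have al : (a - q) * (56 / 100) <= 2 * r.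
    have : 0 <= (a - q - b) * c by rewrite mulr_ge0// ltW.
    have : 0 <= (a - q) * (3 / 7 - c) by rewrite mulr_ge0 ?subr_ge0.
    by clear -det kappa k1 k2 bd0 aq; lra.
  by apply/orP; right; apply/and3P; split; clear -al ab c41 r0; lra.
(* Case d - c >= q: then c <= d - q, so a d - 1 = b c <= b (d - q), that is, q (a - q) + (d - q) (a
   - b) <= 2 r. Both terms are nonnegative because a - b >= 99/100 - 13/24 > 4/9. *)
have cd : 0 <= d - q - c by move: s3; rewrite gtr0_norm; clear -c41 dq q99; lra.
have k3 : 0 <= b * (d - q - c) by rewrite mulr_ge0.
have h : q * (a - q) + (d - q) * (a - b) <= 2 * r by clear -k3 det kappa; lra.
have k4 : 0 <= (d - q) * (a - b - 4 / 9).
  by rewrite mulr_ge0// ?subr_ge0//; clear -b2 aq q99; lra.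
have k5 : 0 <= q * (a - q) by rewrite mulr_ge0 ?subr_ge0// ltW.
have al : a - q <= 4 * r by clear -h k1 k4 dq r0; lra.
have be : d - q <= 5 * r by clear -h k5 k4 r0; lra.
by apply/orP; left; apply/and3P; split; clear -al be cd b2; lra.
Qed.

Lemma outer_core q r t a b c d :
  0 < t -> r = t ^+ 2 -> r <= 200^-1 -> 0 < q -> q < 1 -> 1 - q ^+ 2 <= 2 * r ->
  a * d - b * c = 1 -> reducedb ((a, c), (b, d)) -> shortfree q a b c d ->
  0 < a -> 0 <= b -> `|c| <= a -> outer q r t ((a, c), (b, d)).
Proof.
move=> t0 rt r200 q0 q1 q2 det red /and4P[s1 s2 s3 s4] a0 b0 ca.
have r0 : 0 < r by rewrite rt exprn_gt0.
have qq : 99 / 100 <= q ^+ 2 by clear -q2 r200; lra.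
have q99 : 99 / 100 <= q.
  by apply: (le_trans qq); rewrite expr2 ger_pMl// ltW.
(* Some coordinate of v1 has absolute value at least q, and |c| <= a. *)
have aq : q <= a.
  case/orP: s1 => h; first by rewrite (gtr0_norm a0) in h.
  exact: le_trans ca.
have aa : 99 / 100 <= a ^+ 2.
  by apply: (le_trans qq); rewrite ler_pXn2r ?nnegrE// ltW.
have [a1 c41' c41 b96 [d0 b2]] := reducedb_bounds a0 aa det red.
(* Since b <= 39/40 < q, the coordinate of v2 that is at least q must be d. *)
have dq : q <= d.
  case/orP: s2; last by rewrite gtr0_norm.
  by rewrite ger0_norm// => h; move: (le_trans h b96); clear -q99; lra.
have [v12 _] := andP red.
have [c0|c0] := leP c 0.
  by rewrite /outer orbA outer_nonpos// (le_trans b96)//; clear; lra.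
by rewrite /outer orbA (outer_pos _ q99)// ?orbT// b2.
Qed.

Lemma reducedbNN a b c d : reducedb ((- a, - c), (- b, - d)) = reducedb ((a, c), (b, d)).
Proof. by rewrite /reducedb/= !sqrrN !mulrNN. Qed.

(* Reflection in the first coordinate axis, followed by v2 |-> - v2. *)
Lemma reducedb_flip a b c d : reducedb ((a, - c), (- b, d)) = reducedb ((a, c), (b, d)).
Proof. by rewrite /reducedb/= !sqrrN mulrN mulNr -opprD normrN. Qed.

Lemma outerNN q r t a b c d : outer q r t ((- a, - c), (- b, - d)) = outer q r t ((a, c), (b, d)).
Proof. by rewrite /outer /hyp /box/= !normrN mulrNN. Qed.

Lemma outer_flip q r t a b c d : outer q r t ((a, - c), (- b, d)) = outer q r t ((a, c), (b, d)).
Proof. by rewrite /outer /hyp /box/= !normrN mulrNN. Qed.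

Lemma shortfreeNN q a b c d : shortfree q (- a) (- b) (- c) (- d) = shortfree q a b c d.
Proof. by rewrite /shortfree -!opprD !normrN. Qed.

Lemma shortfree_flip q a b c d : shortfree q a (- b) (- c) d = shortfree q a b c d.
Proof.
have e1 : `|- b - a| = `|b + a| by rewrite -opprD normrN.
have e2 : `|- b + a| = `|b - a| by rewrite addrC distrC.
by rewrite /shortfree !normrN e1 e2 opprK; congr (_ && (_ && _)); exact: andbC.
Qed.

(** Negating both basis vectors makes a nonnegative; the flip of [reducedb_flip] then makes b
    nonnegative and leaves a and d unchanged. This reduces the claim to [outer_core]. *)
Lemma outer_dominant q r t a b c d :
  0 < t -> r = t ^+ 2 -> r <= 200^-1 -> 0 < q -> q < 1 -> 1 - q ^+ 2 <= 2 * r ->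
  a * d - b * c = 1 -> reducedb ((a, c), (b, d)) -> shortfree q a b c d ->
  `|c| <= `|a| -> outer q r t ((a, c), (b, d)).
Proof.
move=> t0 rt r200 q0 q1 q2.
wlog a0 : a b c d / 0 <= a => [H|].
  have [a0|a0] := leP 0 a; first exact: H.
  move=> det red sf ca; rewrite -outerNN; apply: H.
  - by rewrite oppr_ge0 ltW.
  - by rewrite !mulrNN.
  - by rewrite reducedbNN.
  - by rewrite shortfreeNN.
  - by rewrite !normrN.
wlog b0 : b c / 0 <= b => [H|].
  have [b0|b0] := leP 0 b; first exact: H.
  move=> det red sf ca; rewrite -outer_flip; apply: H.
  - by rewrite oppr_ge0 ltW.
  - by rewrite !mulrNN.
  - by rewrite reducedb_flip.
  - by rewrite shortfree_flip.
  - by rewrite !normrN.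
move=> det red sf; rewrite (ger0_norm a0) => ca.
(* If a = 0 then |c| <= a gives c = 0, contradicting determinant 1. *)
apply: outer_core => //; rewrite lt_neqAle a0 andbT; apply/eqP => a00.
move: ca det; rewrite -a00 normr_le0 => /eqP ->.
by rewrite mul0r mulr0 subr0 => /esym/eqP; rewrite oner_eq0.
Qed.

End inclusions.

(** * Lattices in [K r]: short vectors, the outer cover and the inner region *)

Section lattice.
Context {R : realType}.
Implicit Types (g : mat2 R) (r : R).

Lemma supnorm_ge0 (v : R * R) : 0 <= supnorm v.
Proof. by rewrite /supnorm le_max normr_ge0. Qed.

Lemma normr_intr_ge1 (m : int) : m != 0 -> 1 <= `|m%:~R| :> R.
Proof. by move=> m0; rewrite -intr_norm ler1z -gtz0_ge1 normr_gt0. Qed.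

(** By Cramer's rule m = d v.1 - b v.2 and n = a v.2 - c v.1, and one of these integers is nonzero.
    The lemma bounds the set in [Delta] from above; on an unbounded set [sup] would take its default
    value 0. *)
Lemma supnorm_latvec_lb g (m n : int) : det2 g = 1 -> (m, n) != (0, 0) ->
  1 <= (`|g.1.1| + `|g.1.2| + `|g.2.1| + `|g.2.2|) * supnorm (latvec g m n).
Proof.
case: g => [[a c] [b d]] det mn0 /=.
set v := latvec _ _ _; set N := supnorm v.
have v1 : `|v.1| <= N by rewrite /N /supnorm le_max lexx.
have v2 : `|v.2| <= N by rewrite /N /supnorm le_max lexx orbT.
have N0 : 0 <= N by exact: supnorm_ge0.
have key (x y : R) : `|x * v.1 - y * v.2| <= (`|x| + `|y|) * N.
  apply: (le_trans (ler_normB _ _)); rewrite !normrM mulrDl.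
  by rewrite lerD// ler_wpM2l.
have le_sum (x y : R) : x + y <= `|a| + `|c| + `|b| + `|d| -> (x + y) * N <= (`|a| + `|c| + `|b| + `|d|) * N.
  by move=> h; rewrite ler_wpM2r.
have a0 := normr_ge0 a; have b0 := normr_ge0 b; have c0 := normr_ge0 c; have d0 := normr_ge0 d.
have [m0|m0] := eqVneq m 0.
  have n0 : n != 0 by move: mn0; rewrite m0 xpair_eqE eqxx.
  apply: (le_trans (normr_intr_ge1 n0)).
  have : n%:~R * det2 ((a, c), (b, d)) = - (c * v.1 - a * v.2).
    by rewrite /v /latvec /det2/=; ring.
  rewrite det mulr1 => ->.
  by rewrite normrN; apply: (le_trans (key _ _)); apply: le_sum; lra.
apply: (le_trans (normr_intr_ge1 m0)).
have : m%:~R * det2 ((a, c), (b, d)) = d * v.1 - b * v.2.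
  by rewrite /v /latvec /det2/=; ring.
rewrite det mulr1 => ->.
by apply: (le_trans (key _ _)); apply: le_sum; lra.
Qed.

Lemma K_supnorm_ge g r : det2 g = 1 -> K r g ->
  forall m n : int, (m, n) != (0, 0) -> expR (- r) <= supnorm (latvec g m n).
Proof.
move=> det /andP[_ Dr] m n mn0.
set S := `|g.1.1| + `|g.1.2| + `|g.2.1| + `|g.2.2|.
have S0 : 0 <= S by rewrite !addr_ge0.
have lb m' n' : (m', n') != (0, 0) -> 0 < supnorm (latvec g m' n') /\ (supnorm (latvec g m' n'))^-1 <= S.
  move=> h; have := supnorm_latvec_lb det h; rewrite -/S => h1.
  have N0 : 0 < supnorm (latvec g m' n').
    rewrite lt_neqAle supnorm_ge0 andbT; apply/eqP => e.
    by move: h1; rewrite -e mulr0 ler10.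
  by split => //; rewrite -div1r ler_pdivrMr.
have [N0 NS] := lb _ _ mn0.
have ub : has_ubound [set x : R | exists m n : int, (m, n) != (0, 0) /\
                   x = ln (1 / supnorm (latvec g m n))].
  exists (ln S) => _ [m' [n' [h ->]]]; have [M0 MS] := lb _ _ h.
  by rewrite div1r ler_ln ?posrE ?invr_gt0// (lt_le_trans _ MS)// invr_gt0.
have : ln (1 / supnorm (latvec g m n)) <= r.
  by apply: le_trans Dr; apply: ub_le_sup => //; exists m, n.
rewrite div1r lnV ?posrE// lerNl => h.
by rewrite -[leRHS]lnK ?posrE// ler_expR.
Qed.

(** The first hypothesis makes r an upper bound in [Delta]; the vector of norm at most 1 contributes
    a nonnegative logarithm, whence 0 <= [Delta g]. *)
Lemma K_of_supnorm g r :
  (forall m n : int, (m, n) != (0, 0) -> expR (- r) <= supnorm (latvec g m n)) ->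
  (exists m n : int, (m, n) != (0, 0) /\ supnorm (latvec g m n) <= 1) -> K r g.
Proof.
move=> lb [m [n [mn0 N1]]].
have pos m' n' : (m', n') != (0, 0) -> 0 < supnorm (latvec g m' n').
  by move=> h; apply: lt_le_trans (lb _ _ h); exact: expR_gt0.
have ub : ubound [set x : R | exists m n : int, (m, n) != (0, 0) /\
                   x = ln (1 / supnorm (latvec g m n))] r.
  move=> _ [m' [n' [h ->]]]; rewrite div1r lnV ?posrE ?pos// lerNl.
  by rewrite -ler_expR lnK ?posrE ?pos// lb.
rewrite /K /= /Delta; apply/andP; split.
  apply: (@le_trans _ _ (ln (1 / supnorm (latvec g m n)))).
    by rewrite div1r lnV ?posrE ?pos// oppr_ge0 ln_le0.
  by apply: ub_le_sup; [exists r|exists m, n].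
by apply: ge_sup => //; exists (ln (1 / supnorm (latvec g m n))), m, n.
Qed.

Lemma supnorm_latvec_rot2 g m n : supnorm (latvec (rot2 g) m n) = supnorm (latvec g m n).
Proof.
case: g => [[a c] [b d]]; rewrite /supnorm /latvec /rot2/=.
by rewrite !mulrN -opprD normrN maxC.
Qed.

Lemma Delta_rot2 g : Delta (rot2 g) = Delta g.
Proof.
congr sup.
by apply/seteqP; split => x [m [n [h ->]]]; exists m, n; rewrite supnorm_latvec_rot2.
Qed.

Lemma K_rot2 g r : K r (rot2 g) = K r g.
Proof. by rewrite /K /= Delta_rot2. Qed.

Lemma reducedb_rot2 g : reducedb (rot2 g) = reducedb g.
Proof.
case: g => [[a c] [b d]]; rewrite /reducedb /rot2/= !sqrrN mulrNN.
by rewrite [c ^+ 2 + _]addrC [d ^+ 2 + _]addrC [c * d + _]addrC.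
Qed.

Lemma K_shortfree g r : det2 g = 1 -> K r g ->
  shortfree (expR (- r)) g.1.1 g.2.1 g.1.2 g.2.2.
Proof.
move=> det Kg; have lb := K_supnorm_ge det Kg.
case: g {det Kg} lb => [[a c] [b d]] lb /=.
apply/and4P; split.
- by have := lb 1 0 isT; rewrite /supnorm /latvec/= !mul1r !mul0r !addr0 le_max.
- by have := lb 0 1 isT; rewrite /supnorm /latvec/= !mul1r !mul0r !add0r le_max.
- have := lb (- 1) 1 isT; rewrite /supnorm /latvec/= mulrN1z !mul1r !mulN1r le_max.
  by rewrite [- a + b]addrC [- c + d]addrC.
- have := lb 1 1 isT; rewrite /supnorm /latvec/= !mul1r le_max.
  by rewrite [a + b]addrC [c + d]addrC.
Qed.

Lemma reducedK_outer g r (t := Num.sqrt r) (q := expR (- r)) :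
  0 < r -> r <= 200^-1 -> det2 g = 1 -> (@reduced R `&` K r) g ->
  outer q r t g || outer q r t (rot2 g).
Proof.
move=> r0 r200 det [red Kg].
have {}red : reducedb g by move: red; rewrite reducedE.
have t0 : 0 < t by rewrite sqrtr_gt0.
have rt : r = t ^+ 2 by rewrite sqr_sqrtr// ltW.
have q0 : 0 < q by exact: expR_gt0.
have q1 : q < 1 by rewrite expR_lt1 oppr_lt0.
have q2 : 1 - q ^+ 2 <= 2 * r.
  have -> : q ^+ 2 = expR (- (2 * r)) by rewrite /q expr2 -expRD; congr expR; ring.
  by have := expR_ge1Dx (- (2 * r)); lra.
have [ca|ac] := leP `|g.1.2| `|g.1.1|.
  apply/orP; left; case: g det Kg red ca => [[a c] [b d]] det Kg red ca.
  by apply: outer_dominant => //; exact: (K_shortfree det Kg).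
apply/orP; right.
have det' : det2 (rot2 g) = 1 by rewrite det2_rot2.
have Kg' : K r (rot2 g) by rewrite K_rot2.
have red' : reducedb (rot2 g) by rewrite reducedb_rot2.
case: g {det Kg red} ac det' Kg' red' => [[a c] [b d]] ac det' Kg' red'.
apply: outer_dominant => //; first exact: (K_shortfree det' Kg').
by rewrite normrN ltW.
Qed.

Lemma normD_sgn (x y : R) : 0 <= x * y -> `|x| <= `|x + y|.
Proof.
have [x0|x0] := leP 0 x; have [y0|y0] := leP 0 y => xy.
- by rewrite !ger0_norm ?addr_ge0// lerDl.
- have -> : x = 0 by apply/eqP; rewrite eq_le x0 andbT; move: xy; rewrite nmulr_lge0.
  by rewrite normr0.
- have -> : y = 0 by apply/eqP; rewrite eq_le y0 andbT; move: xy; rewrite nmulr_rge0.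
  by rewrite addr0.
- by rewrite !ler0_norm ?ltW//; lra.
Qed.

(** The products (x a) (y b) and (y d) (x c) multiply to (x y)^2 (a d) (b c) <= 0, so one of them is
    nonnegative. In that coordinate nothing cancels, and it is at least |x a| or |y d|. If m = 0,
    the second coordinate is y d alone. *)
Lemma supnorm_latvec_opposite (a b c d q : R) (m n : int) :
  0 < a * d -> b * c <= 0 -> q <= `|a| -> q <= `|d| -> (m, n) != (0, 0) ->
  q <= supnorm (latvec ((a, c), (b, d)) m n).
Proof.
move=> ad bc qa qd mn0; rewrite /supnorm /latvec/= le_max.
set x := m%:~R : R; set y := n%:~R : R.
have big z (k : int) : q <= `|z| -> k != 0 -> q <= `|k%:~R * z|.
  move=> qz k0; apply: (le_trans qz); rewrite normrM ler_peMl//.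
  exact: normr_intr_ge1.
have [h|h] := leP 0 ((x * a) * (y * b)).
  have [m0|m0] := eqVneq m 0.
    apply/orP; right; rewrite /x m0 mul0r add0r; apply: big => //.
    by move: mn0; rewrite m0 xpair_eqE eqxx.
  by apply/orP; left; apply: le_trans (normD_sgn h); exact: big.
apply/orP; right; rewrite addrC.
apply: le_trans (@normD_sgn (y * d) (x * c) _).
  apply: big => //; apply/eqP => n0; move: h; rewrite /y n0 mul0r mulr0.
  by rewrite ltxx.
rewrite leNgt; apply/negP => h'.
have : 0 < (y * d) * (x * c) * ((x * a) * (y * b)) by rewrite nmulr_rgt0.
have -> : (y * d) * (x * c) * ((x * a) * (y * b)) = (x * y) ^+ 2 * ((a * d) * (b * c)) by ring.
rewrite ltNge => /negP; apply; apply: mulr_ge0_le0; first exact: sqr_ge0.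
exact: mulr_ge0_le0 (ltW ad) bc.
Qed.

(** Here a d = 1 - |b| |c| lies between q |a| and 1, whence |d| >= q. Moreover |b| |c| <= 1 - q^2 <=
    2 t^2, and dividing by |b| >= 3 t bounds c. *)
Lemma inner_bounds (q r t a b c d : R) :
  0 < t -> r = t ^+ 2 -> r <= 200^-1 -> 0 < q -> 1 - q ^+ 2 <= 2 * r ->
  a * d - b * c = 1 -> hyp q (3 * t) 4^-1 ((a, c), (b, d)) ->
  [/\ 99 / 100 <= q ^+ 2, 0 < a * d, q <= `|d|, `|a| * `|d| <= 1 & `|c| <= 2 / 3 * t].
Proof.
move=> t0 rt r200 q0 kappa det /and4P[/= qa /andP[tb b4] bc0 bc].
have r0 : 0 < r by rewrite rt exprn_gt0.
have q2 : 99 / 100 <= q ^+ 2 by clear -kappa r200; lra.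
have bcE : `|b| * `|c| = - (b * c) by rewrite -normrM ler0_norm.
have a0 : 0 < `|a| by exact: lt_le_trans qa.
have qa2 : q ^+ 2 <= q * `|a| by rewrite expr2 ler_pM2l.
have ad0 : 0 < a * d by rewrite bcE in bc; clear -bc det qa2 q2; lra.
have adE : `|a| * `|d| = a * d by rewrite -normrM gtr0_norm.
split => //.
- rewrite -(ler_pM2l a0) adE; rewrite bcE in bc; clear -bc det; lra.
- by rewrite adE; clear -det bc0; lra.
- have : 3 * t * `|c| <= `|b| * `|c| by rewrite ler_wpM2r.
  move=> h; have : 3 * t * `|c| <= 3 * t * (2 / 3 * t).
    apply: (le_trans h); apply: (le_trans bc).
    by rewrite (_ : 3 * t * (2 / 3 * t) = 2 * t ^+ 2); [rewrite -rt; clear -qa2 kappa; lra|field].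
  by rewrite ler_pM2l// mulr_gt0.
Qed.

(** The factor 3 in 3 t serves the lengths: |v1|^2 <= 1 + (21/10 + 4/9) r, whereas |v2|^2 >= 9 r + 1
    - 2 r. The bound |b| <= 1/4 serves the inner product: 2 (|a b| + |c d|) < 7/10, below a^2. *)
Lemma inner_reducedb (q r t a b c d : R) :
  0 < t -> r = t ^+ 2 -> r <= 200^-1 -> 0 < q -> 1 - q ^+ 2 <= 2 * r ->
  a * d - b * c = 1 -> hyp q (3 * t) 4^-1 ((a, c), (b, d)) ->
  reducedb ((a, c), (b, d)).
Proof.
move=> t0 rt r200 q0 kappa det h.
have [q2 ad0 qd ad1 c1] := inner_bounds t0 rt r200 q0 kappa det h.
case/and4P: h => /= qa /andP[tb b4] _ _.
have r0 : 0 < r by rewrite rt exprn_gt0.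
have a0 := lt_le_trans q0 qa; have d0 := lt_le_trans q0 qd.
rewrite /reducedb/= -[a ^+ 2]real_normK ?num_real// -[b ^+ 2]real_normK ?num_real//.
rewrite -[c ^+ 2]real_normK ?num_real// -[d ^+ 2]real_normK ?num_real//.
have X : `|a * b + c * d| <= `|a| * `|b| + `|c| * `|d|.
  by apply: (le_trans (ler_normD _ _)); rewrite !normrM.
move: X; move: `|a * b + c * d| => X.
have b0 := normr_ge0 b; have c0 := normr_ge0 c.
move: `|a| `|b| `|c| `|d| qa tb b4 qd ad1 c1 a0 d0 b0 c0.
clear -t0 rt r200 q0 kappa q2 r0.
move=> {}a {}b {}c {}d qa tb b4 qd ad1 c1 a0 d0 b0 c0 X1.
have qa2 : q ^+ 2 <= a ^+ 2 by rewrite ler_pXn2r ?nnegrE// ltW.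
have qd2 : q ^+ 2 <= d ^+ 2 by rewrite ler_pXn2r ?nnegrE// ltW.
have a2d2 : a ^+ 2 * d ^+ 2 <= 1 by rewrite -exprMn expr_le1// mulr_ge0// ltW.
have hc : c ^+ 2 <= 4 / 9 * r.
  have : c ^+ 2 <= (2 / 3 * t) ^+ 2 by rewrite ler_pXn2r ?nnegrE//; clear -t0; lra.
  by rewrite exprMn -rt => hh; apply: (le_trans hh); rewrite expr2; clear; lra.
have hb : 9 * r <= b ^+ 2.
  have : (3 * t) ^+ 2 <= b ^+ 2 by rewrite ler_pXn2r ?nnegrE//; clear -t0; lra.
  by rewrite exprMn -rt; apply: le_trans; clear; lra.
have tt : t <= 1 / 10.
  suff [_ tt] : - (1 / 10) <= t /\ t <= 1 / 10 by [].
  by apply: sqr_le_bounds; rewrite -?rt; clear -r200; lra.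
(* With z = x^2 and z (1 - 2 r) <= 1, the crude bound z <= 102/100 is fed back into z <= 1 + 2 r
   z. *)
have ad2 (x y : R) : 0 <= y -> x ^+ 2 * y ^+ 2 <= 1 -> q ^+ 2 <= y ^+ 2 -> x ^+ 2 <= 1 + 21 / 10 * r.
  move=> y0 xy qy.
  have : x ^+ 2 * (1 - 2 * r) <= 1.
    by apply: le_trans xy; rewrite ler_wpM2l ?sqr_ge0//; clear -kappa qy; lra.
  have h : 0 <= x ^+ 2 by exact: sqr_ge0.
  move: (x ^+ 2) h => z h hz.
  have : z <= 102 / 100.
    have : z * (2 * r) <= z * (2 * 200^-1) by rewrite ler_wpM2l// ler_pM2l.
    by clear -hz; lra.
  move=> z1; have : z * r <= 102 / 100 * r by rewrite ler_pM2r.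
  by clear -hz r0; lra.
have ha : a ^+ 2 <= 1 + 21 / 10 * r by apply: (ad2 _ d) => //; exact: ltW.
have hd : d ^+ 2 <= 1 + 21 / 10 * r.
  by apply: (ad2 _ a); [exact: ltW|rewrite mulrC|].
have [_ a1] : - (11 / 10) <= a /\ a <= 11 / 10.
  by apply: sqr_le_bounds; clear -ha r200; lra.
have [_ d1] : - (11 / 10) <= d /\ d <= 11 / 10.
  by apply: sqr_le_bounds; clear -hd r200; lra.
apply/andP; split; first by clear -ha hb hc qd2 kappa r0; lra.
have : a * b <= 11 / 10 * 4^-1 by apply: ler_pM => //; exact: ltW.
have : c * d <= 2 / 3 * (1 / 10) * (11 / 10).
  apply: ler_pM => //; first exact: ltW.
  by apply: (le_trans c1); clear -tt; lra.
have := sqr_ge0 c.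
by clear -X1 qa2 q2; lra.
Qed.

Lemma inner_reducedK g r (t := Num.sqrt r) (q := expR (- r)) :
  0 < r -> r <= 200^-1 -> det2 g = 1 -> hyp q (3 * t) 4^-1 g -> (@reduced R `&` K r) g.
Proof.
move=> r0 r200; case: g => [[a c] [b d]] det h.
have t0 : 0 < t by rewrite sqrtr_gt0.
have rt : r = t ^+ 2 by rewrite sqr_sqrtr// ltW.
have q0 : 0 < q by exact: expR_gt0.
have q2 : 1 - q ^+ 2 <= 2 * r.
  have -> : q ^+ 2 = expR (- (2 * r)) by rewrite /q expr2 -expRD; congr expR; ring.
  by have := expR_ge1Dx (- (2 * r)); lra.
have [_ ad0 qd ad1 c1] := inner_bounds t0 rt r200 q0 q2 det h.
split; first by rewrite reducedE; exact: inner_reducedb q2 det h.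
case/and4P: h => /= qa /andP[tb b4] bc _.
apply: K_of_supnorm; first by move=> m n mn0; exact: supnorm_latvec_opposite.
have c11 : `|c| <= 1.
  apply: (le_trans c1).
  suff [_ tt] : - 1 <= t /\ t <= 1 by clear -tt; lra.
  by apply: sqr_le_bounds; rewrite -?rt; clear -r200; lra.
(* A vector of norm at most 1: v1 if |a| <= 1, and otherwise v2, since |a| |d| <= 1 then gives |d|
   <= 1. *)
have [a1|a1] := leP `|a| 1.
  exists 1, 0; split => //; rewrite /supnorm /latvec/= !mul1r !mul0r !addr0.
  by rewrite ge_max a1.
exists 0, 1; split => //; rewrite /supnorm /latvec/= !mul1r !mul0r !add0r.
rewrite ge_max (le_trans b4)/=; last by clear; lra.
by apply: le_trans ad1; rewrite ler_peMl// ltW.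
Qed.

(** Membership of both [g] and [rot2 g] would give |a| >= q and |c| >= q, so 3 t q <= |b| |c| <= 1 -
    q^2 <= 2 t^2. This forces 3 q <= 2 t, impossible for q near 1 and t small. *)
Lemma hyp_rot2_disjoint (r t q : R) g : 0 < t -> r = t ^+ 2 -> r <= 200^-1 -> 0 < q ->
  1 - q ^+ 2 <= 2 * r ->
  hyp q (3 * t) 4^-1 g -> hyp q (3 * t) 4^-1 (rot2 g) -> False.
Proof.
case: g => [[a c] [b d]] t0 rt r200 q0 kappa.
case/and4P => /= qa /andP[tb b4] _ bc /and4P[/= qc _ _ _].
rewrite normrN in qc.
have a0 : 0 < `|a| by exact: lt_le_trans qa.
have qa2 : q ^+ 2 <= q * `|a| by rewrite expr2 ler_pM2l.
have h : 3 * t * q <= 2 * t ^+ 2.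
  rewrite -rt; apply: le_trans kappa; apply: (@le_trans _ _ (1 - q * `|a|)); last first.
    by clear -qa2; lra.
  by apply: le_trans bc; apply: ler_pM => //; [rewrite mulr_ge0// ltW|exact: ltW].
have q99 : 99 / 100 <= q ^+ 2 by clear -kappa r200; lra.
have h2 : 3 * q <= 2 * t.
  by rewrite -(ler_pM2l t0); clear -h; lra.
have : (3 * q) ^+ 2 <= (2 * t) ^+ 2 by rewrite ler_pXn2r ?nnegrE ?mulr_ge0// ?ltW.
by rewrite !exprMn -rt; clear -q99 r200; lra.
Qed.

End lattice.

(** * The asymptotics *)

Section asymptotics.
Context {R : realType}.
Implicit Types (r q : R).

Lemma measurable_outer (q r t : R) : measurable_fun [set: mat2 R] (outer q r t).
Proof.
by rewrite /outer; repeat apply: measurable_or; (exact: measurable_hyp || exact: measurable_box).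
Qed.

Lemma leb4_cone_outer (r t q : R) : 0 < t -> t < 1 -> r = t ^+ 2 -> 2^-1 <= q -> q < 1 ->
  (leb4 (cone [set g | outer q r t g]) <=
   (- ln t * ((1 - q ^+ 2) ^+ 2 / q ^+ 2) + 384 * r ^+ 2)%:E)%E.
Proof.
move=> t0 t1 rt q2 q1.
have q0 : 0 < q by apply: lt_le_trans q2.
have r0 : 0 < r by rewrite rt exprn_gt0.
have mb := @measurable_box R; have mh := @measurable_hyp R.
have qq : q <= q + 4 * r by rewrite lerDl mulr_ge0// ltW.
have /andP[_ h1] := @leb4_cone_hyp R q t 1 q0 q1 t0 t1.
have h2 := @leb4_cone_box R q (q + 4 * r) t (3 * t) q2 qq (ltW t0) (mulr_ge0 (ler0n _ 3) (ltW t0)).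
have h3 := @leb4_cone_box R q (q + 4 * r) 1 (5 * r) q2 qq ler01 (mulr_ge0 (ler0n _ 5) (ltW r0)).
have h4 := @leb4_cone_box R q (q + 4 * r) (4 * r) 1 q2 qq (mulr_ge0 (ler0n _ 4) (ltW r0)) ler01.
apply: le_trans (leb4_cone_or _ _) _ => //; first by repeat apply: measurable_or.
apply: le_trans (leeD h1 (le_trans (leb4_cone_or _ _) (leeD h2 (le_trans (leb4_cone_or _ _) (leeD h3 h4))))) _ => //.
  by repeat apply: measurable_or.
(* The three boxes contribute 96 r^2, 160 r^2 and 128 r^2, in total 384 r^2. *)
rewrite -!EFinD lee_fin ln1 sub0r lerD2l.
by rewrite le_eqVlt; apply/orP; left; apply/eqP; rewrite rt; ring.
Qed.

(** The inequality exp x >= 1 + x at x = - 2 r gives the upper bound on 1 - q^2, and at x = 2 r it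
    gives q^2 (1 + 2 r) <= 1, hence the lower one. *)
Lemma expRN2_bounds r : 0 < r -> r <= 200^-1 -> let q := expR (- r) in
  [/\ q < 1, 1 - q ^+ 2 <= 2 * r, 2 * r * (1 - 2 * r) <= 1 - q ^+ 2, 99 / 100 <= q ^+ 2 & 2^-1 <= q].
Proof.
move=> r0 r200 q.
have q0 : 0 < q by exact: expR_gt0.
have q1 : q < 1 by rewrite expR_lt1 oppr_lt0.
have qE : q ^+ 2 = expR (- (2 * r)) by rewrite /q expr2 -expRD; congr expR; ring.
have k1 : 1 - q ^+ 2 <= 2 * r by have := expR_ge1Dx (- (2 * r)); rewrite qE; lra.
have k2 : q ^+ 2 * (1 + 2 * r) <= 1.
  have e : q ^+ 2 * expR (2 * r) = 1 by rewrite qE -expRD addNr expR0.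
  by rewrite -[leRHS]e ler_pM2l ?exprn_gt0// expR_ge1Dx.
have q2 : 99 / 100 <= q ^+ 2 by clear -k1 r200; lra.
split => //.
  have : q ^+ 2 * r <= 1 * r by rewrite ler_pM2r//; apply: ltW; rewrite expr_lt1// ltW.
  have : (1 - q ^+ 2) * r <= 2 * r * r by rewrite ler_pM2r.
  by clear -k2; lra.
have : q ^+ 2 <= q by rewrite expr2 ger_pMl// ltW.
by clear -q2; lra.
Qed.

(** The inner region and the outer cover each consist of a set and its quarter turn. Since - ln t is
    half of ln (1/r), the two copies together give the full logarithm. Errors of order r^3 ln (1/r)
    are O(r^2), because r ln (1/r) <= 1. *)
Lemma reducedK_bounds r : 0 < r -> r <= 200^-1 ->
  ((4 * r ^+ 2 * ln (1 / r) - 112 * r ^+ 2)%:E <= leb4 (cone (@reduced R `&` K r)) <=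
   (4 * r ^+ 2 * ln (1 / r) + 780 * r ^+ 2)%:E)%E.
Proof.
move=> r0 r200; rewrite div1r.
have [q1 k1 k2 q99 q2] := expRN2_bounds r0 r200.
set q := expR (- r) in q1 k1 k2 q99 q2.
have q0 : 0 < q by exact: expR_gt0.
pose t := Num.sqrt r.
have t0 : 0 < t by rewrite sqrtr_gt0.
have rt : r = t ^+ 2 by rewrite sqr_sqrtr// ltW.
(* Here 14^2 < 200, and 3/14 < 1/4 makes the b-range [3 t, 1/4] of the inner region
   nondegenerate. *)
have [_ t14] : - (1 / 14) <= t /\ t <= 1 / 14.
  by apply: sqr_le_bounds; rewrite -?rt; clear -r200; lra.
have lnt : ln r^-1 = 2 * - ln t.
  by rewrite lnV ?posrE// [in LHS]rt lnXn// mulr2n; ring.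
have l0 : 0 <= ln r^-1.
  by rewrite ln_ge0// invf_ge1//; clear -r200; lra.
have rl : r * ln r^-1 <= 1.
  by rewrite -ler_pdivlMl// mulr1; apply/ltW/ln_sublinear; rewrite invr_gt0.
move: lnt l0 rl; set l := ln r^-1 => lnt l0 rl.
have lntE : ln t = - (l / 2) by clear -lnt; lra.
apply/andP; split.
- have mh := @measurable_hyp R q (3 * t) 4^-1.
  have mh' := measurable_rot2 mh.
  apply: (@le_trans _ _ (leb4 (cone [set g | hyp q (3 * t) 4^-1 g || hyp q (3 * t) 4^-1 (rot2 g)]))); last first.
    apply: leb4_cone_ge => g det /orP[h|h]; first exact: inner_reducedK.
    have [] := @inner_reducedK R (rot2 g) r r0 r200 _ h; first by rewrite det2_rot2.
    by rewrite reducedE /= reducedb_rot2 K_rot2.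
  rewrite leb4_cone_or_disj//; last by move=> g; exact: hyp_rot2_disjoint k1.
  rewrite leb4_cone_rot2//.
  have /andP[h _] := @leb4_cone_hyp R q (3 * t) 4^-1 q0 q1 (mulr_gt0 (ltr0Sn _ 2) t0) ltac:(clear -t14; lra).
  apply: le_trans (leeD h h); rewrite -EFinD lee_fin.
  rewrite lnV ?posrE// lnM ?posrE//.
  have ln12 : ln 4 + ln 3 <= 7 :> R.
    by have := @ln_sublinear R 4 ltac:(lra); have := @ln_sublinear R 3 ltac:(lra); clear; lra.
  have kk : 4 * r ^+ 2 * (1 - 4 * r) <= (1 - q ^+ 2) ^+ 2.
    have : (2 * r * (1 - 2 * r)) ^+ 2 <= (1 - q ^+ 2) ^+ 2.
      rewrite ler_pXn2r ?nnegrE//; last by apply: le_trans k2; rewrite !mulr_ge0//; clear -r0 r200; lra.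
      by rewrite !mulr_ge0//; clear -r0 r200; lra.
    apply: le_trans; have : 0 <= r ^+ 2 * r ^+ 2 by rewrite mulr_ge0 ?sqr_ge0.
    by clear; lra.
  have kk' : (1 - q ^+ 2) ^+ 2 <= 4 * r ^+ 2.
    have -> : 4 * r ^+ 2 = (2 * r) ^+ 2 by ring.
    by rewrite ler_pXn2r ?nnegrE//; [apply: le_trans k2; rewrite !mulr_ge0|rewrite mulr_ge0]; clear -r0 r200; lra.
  move: kk kk' (sqr_ge0 (1 - q ^+ 2)); move: ((1 - q ^+ 2) ^+ 2) => k kk kk' k0.
  (* The loss is at most 16 r^2 from the factor 1 - 4 r and 2 * 7 * 4 r^2 = 56 r^2 from ln 12 <= 7,
     within the allowed 112 r^2. *)
  have e1 : 4 * r ^+ 2 * (1 - 4 * r) * l <= k * l by rewrite ler_wpM2r.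
  have e2 : r ^+ 2 * (r * l) <= r ^+ 2 * 1 by rewrite ler_wpM2l// sqr_ge0.
  have e3 : (ln 4 + ln 3) * k <= 7 * (4 * r ^+ 2).
    apply: (@le_trans _ _ (7 * k)); last by rewrite ler_pM2l.
    by rewrite ler_wpM2r.
  have := sqr_ge0 r.
  by rewrite lntE; clear -e1 e2 e3; lra.
- have mo := @measurable_outer q r t.
  apply: (@le_trans _ _ (leb4 (cone [set g | outer q r t g || outer q r t (rot2 g)]))).
    by apply: leb4_cone_le => g det h; exact: reducedK_outer.
  apply: (le_trans (leb4_cone_or mo (measurable_rot2 mo))).
  rewrite leb4_cone_rot2//.
  have h := @leb4_cone_outer r t q t0 ltac:(clear -t14; lra) rt q2 q1.
  apply: (le_trans (leeD h h)); rewrite -EFinD lee_fin.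
  have kk : (1 - q ^+ 2) ^+ 2 / q ^+ 2 <= 4 * r ^+ 2 * (1 + 3 * r).
    rewrite ler_pdivrMr ?exprn_gt0//.
    have kk' : (1 - q ^+ 2) ^+ 2 <= 4 * r ^+ 2.
      have -> : 4 * r ^+ 2 = (2 * r) ^+ 2 by ring.
      by rewrite ler_pXn2r ?nnegrE//; [apply: le_trans k2; rewrite !mulr_ge0|rewrite mulr_ge0]; clear -r0 r200; lra.
    apply: (le_trans kk'); rewrite -[leLHS]mulr1 -[leRHS]mulrA ler_wpM2l//; first by rewrite mulr_ge0// sqr_ge0.
    have h1 : (1 + 3 * r) * (1 - 2 * r) <= (1 + 3 * r) * q ^+ 2.
      by rewrite ler_wpM2l//; clear -k1 r0; lra.
    apply: le_trans h1.
    have : r * r <= 200^-1 * r by rewrite ler_pM2r.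
    by clear -r0; lra.
  move: kk; move: ((1 - q ^+ 2) ^+ 2 / q ^+ 2) => k kk.
  (* The excess is 12 r^2 from the factor 1 + 3 r and 2 * 384 r^2 from the boxes, which makes 780
     r^2. *)
  have e1 : k * l <= 4 * r ^+ 2 * (1 + 3 * r) * l by rewrite ler_wpM2r.
  have e2 : r ^+ 2 * (r * l) <= r ^+ 2 * 1 by rewrite ler_wpM2l// sqr_ge0.
  by rewrite lntE; clear -e1 e2; lra.
Qed.

End asymptotics.

Theorem theorem1p2 (R : realType) :
  exists C : R, forall r : R, 0 < r -> r < ln 2 / 2 ->
    `| mu (K r) - 4 * r ^+ 2 * ln (1 / r) / zeta2 R | <= C * r ^+ 2.
Proof.
have z0 : 0 < zeta2 R by rewrite divr_gt0// exprn_gt0// pi_gt0.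
have ln2 : ln 2 <= 1 :> R by have := @le_ln1Dx R 1; rewrite (_ : 1 + 1 = 2)//; apply; lra.
(* For r <= 1/200 the constant 780 / zeta(2) suffices. For larger r the trivial bound 1 + 4 r /
   zeta(2) is at most 200^2 r^2 + 800 r^2 / zeta(2), and 1580 = 780 + 800. *)
exists (200 ^+ 2 + 1580 / zeta2 R) => r r0 r2.
have r1 : r <= 2^-1 by lra.
set l := ln (1 / r).
have l0 : 0 <= l.
  by rewrite /l div1r ln_ge0// invf_ge1//; lra.
have rl : r * l <= 1.
  rewrite /l div1r -ler_pdivlMl// mulr1; apply/ltW/ln_sublinear.
  by rewrite invr_gt0.
rewrite /mu leb4_cone_reduced /= -/(zeta2 R).
set V := leb4 _.
(* Comparison with the covolume shows that [V] is finite, so [fine] returns its true value, and that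
   [mu (K r)] is at most 1. *)
have VZ : (V <= (zeta2 R)%:E)%E.
  by rewrite /zeta2 -leb4_cone_reduced; apply: le_leb4 => M [h [h1 _]].
have V0 : (0 <= V)%E by apply: integral_ge0.
have VE : V = (fine V)%:E.
  by rewrite fineK// ge0_fin_numE// (le_lt_trans VZ)// ltry.
rewrite -mulrBl normrM (gtr0_norm (_ : 0 < (zeta2 R)^-1)) ?invr_gt0//.
rewrite ler_pdivrMr//.
have -> : (200 ^+ 2 + 1580 / zeta2 R) * r ^+ 2 * zeta2 R = (zeta2 R * 200 ^+ 2 + 1580) * r ^+ 2.
  by rewrite mulrAC mulrDl divfK ?gt_eqF// [200 ^+ 2 * _]mulrC.
have [r200|r200] := leP r 200^-1.
  have /andP[] := reducedK_bounds r0 r200; rewrite -/V VE !lee_fin -/l => lo hi.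
  have : `|fine V - 4 * r ^+ 2 * l| <= 780 * r ^+ 2.
    by rewrite ler_norml; have := sqr_ge0 r; lra.
  move=> h; apply: (le_trans h); rewrite ler_wpM2r ?sqr_ge0//.
  apply: ler_wpDl; last by lra.
  by rewrite mulr_ge0// ltW.
(* For r > 1/200 both terms of the difference are bounded separately, using r l <= 1 and 1 <= 200
   r. *)
have v0 : 0 <= fine V by rewrite fine_ge0.
have v1 : fine V <= zeta2 R by rewrite -lee_fin -VE.
have r2l : 4 * r ^+ 2 * l <= 4 * r.
  have : r * (r * l) <= r * 1 by rewrite ler_pM2l.
  by clear; lra.
apply: (@le_trans _ _ (zeta2 R + 4 * r)).
  have r2l0 : 0 <= 4 * r ^+ 2 * l by rewrite mulr_ge0// mulr_ge0// sqr_ge0.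
  by rewrite ler_norml; clear -r2l0 r2l v0 v1 z0 r0; lra.
have h200 : 1 <= 200 * r by clear -r200; lra.
rewrite [leRHS]mulrDl; apply: lerD.
- rewrite -mulrA -[leLHS]mulr1 ler_pM2l// -exprMn exprn_ege1//.
- have : r * 1 <= r * (200 * r) by rewrite ler_pM2l.
  by have := sqr_ge0 r; lra.
Qed.
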